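(* Let $R$ be a commutative Noetherian ring and let $A$ be a projective Noetherian $R$-algebra. Let $Q\in A\text{-mod}\cap R\text{-proj}$ be such that $\operatorname{Hom}_A(Q,Q)\in R\text{-proj}$, and let $B=\operatorname{End}_A(Q)^{op}$. For $M\in A\text{-mod}\cap R\text{-proj}$ let $\chi_M\colon Q\otimes_B\operatorname{Hom}_A(Q,M)\to M$ be $q\otimes g\mapsto g(q)$ and let $\chi^r_{DM}\colon\operatorname{Hom}_A(DQ,DM)\otimes_B DQ\to DM$ be $f\otimes h\mapsto f(h)$. Then for every $M\in A\text{-mod}\cap R\text{-proj}$ and every integer $n\geq 2$: (i) $Q\text{-}\operatorname{codomdim}_{(A,R)}M\geq n$ if and only if $\chi_M$ is an isomorphism of left $A$-modules and $\operatorname{Tor}_i^B(Q,\operatorname{Hom}_A(Q,M))=0$ for $1\leq i\leq n-2$; (ii) $Q\text{-}\operatorname{domdim}_{(A,R)}M\geq n$ if and only if $\chi^r_{DM}$ is an isomorphism and $\operatorname{Tor}_i^B(\operatorname{Hom}_A(DQ,DM),DQ)=\operatorname{Tor}_i^B(\operatorname{Hom}_A(M,Q),DQ)=0$ for $1\leq i\leq n-2$.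
   Context: A projective Noetherian $R$-algebra is an $R$-algebra that is finitely generated and projective as an $R$-module. $A\text{-mod}$ is the category of finitely generated left $A$-modules, $R\text{-proj}$ is the category of finitely generated projective $R$-modules, and $D=\operatorname{Hom}_R(-,R)$, which sends left $A$-modules to right $A$-modules and conversely. For a module $T$, $\operatorname{add}T$ is the full subcategory of direct summands of finite direct sums of copies of $T$. $Q$ is a right $B$-module, $\operatorname{Hom}_A(Q,M)$ and $DQ$ are left $B$-modules, and $\operatorname{Hom}_A(DQ,DM)\cong\operatorname{Hom}_A(M,Q)$ (the first being homomorphisms of right $A$-modules) is a right $B$-module. An exact sequence of $A$-modules is $(A,R)$-exact if it splits as a sequence of $R$-modules; an $(A,R)$-monomorphism is an $A$-homomorphism $f\colon M\to N$ such that $0\to M\xrightarrow{f}N$ is $(A,R)$-exact (i.e. $f$ is split injective over $R$). A left $\operatorname{add}T$-approximation of $X$ is an $A$-homomorphism $X\to N$ with $N\in\operatorname{add}T$ such that $\operatorname{Hom}_A(N,Y)\to\operatorname{Hom}_A(X,Y)$ is surjective for all $Y\in\operatorname{add}T$; a right $\operatorname{add}T$-approximation of $X$ is an $A$-homomorphism $N\to X$ with $N\in\operatorname{add}T$ such that $\operatorname{Hom}_A(Y,N)\to\operatorname{Hom}_A(Y,X)$ is surjective for all $Y\in\operatorname{add}T$. Relative dominant dimension: for $T,X\in A\text{-mod}\cap R\text{-proj}$, if $X$ admits no left $\operatorname{add}T$-approximation which is an $(A,R)$-monomorphism then $T\text{-}\operatorname{domdim}_{(A,R)}X=0$. Otherwise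 it is the supremum in $\mathbb N\cup\{+\infty\}$ of all $n\in\mathbb N$ such that there is an $(A,R)$-exact sequence $0\to X\to T_1\to\cdots\to T_n$ with all $T_i\in\operatorname{add}T$ which remains exact under $\operatorname{Hom}_A(-,T)$ (i.e. $\operatorname{Hom}_A(T_n,T)\to\cdots\to\operatorname{Hom}_A(X,T)\to 0$ is exact). Relative codominant dimension: if $X$ admits no surjective right $\operatorname{add}T$-approximation then $T\text{-}\operatorname{codomdim}_{(A,R)}X=0$. Otherwise it is the supremum in $\mathbb N\cup\{+\infty\}$ of all $n\in\mathbb N$ such that there is an $(A,R)$-exact sequence $T_n\to\cdots\to T_1\to X\to 0$ with all $T_i\in\operatorname{add}T$ which remains exact under $\operatorname{Hom}_A(T,-)$ (i.e. $\operatorname{Hom}_A(T,T_n)\to\cdots\to\operatorname{Hom}_A(T,X)\to 0$ is exact); it is infinite if some $T_i=0$. One has $T\text{-}\operatorname{codomdim}_{(A,R)}X=DT\text{-}\operatorname{domdim}_{(A,R)}DX$. *)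

(* Defs.v *)
From HB Require Import structures.
From mathcomp Require Import all_boot all_algebra.
From mathcomp Require Import boolp classical_sets functions cardinality fsbigop.

Set Implicit Arguments.
Unset Strict Implicit.
Unset Printing Implicit Defensive.

Import GRing.Theory.
Local Open Scope ring_scope.

(** Left [R]-modules are [lmodType R]; right [R]-modules are left modules over
  the converse ring, [lmodType R^c]. Zero rings are allowed throughout: for
  instance [End_A(Q)] vanishes when [Q = 0]. *)

Section LinearMaps.
Variables (R : pzRingType) (U V : lmodType R).
Implicit Types f g h : {linear U -> V}.

HB.instance Definition _ := gen_eqMixin {linear U -> V}.
HB.instance Definition _ := gen_choiceMixin {linear U -> V}.

Lemma linear_eqP f g : f =1 g -> f = g.
Proof.
case: f g => f [[f1] [f2]] [g [[g1] [g2]]] /= /funext fg.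
by move: f1 f2 g1 g2; rewrite fg => *; do 2?congr GRing.Linear.Pack; do ?f_equal.
Qed.

Definition lin_add f g : {linear U -> V} := f \+ g.
Definition lin_zero : {linear U -> V} := \0.
Definition lin_opp f : {linear U -> V} := \- f.

Fact lin_addA : associative lin_add.
Proof. by move=> f g h; apply: linear_eqP => x /=; rewrite addrA. Qed.
Fact lin_addC : commutative lin_add.
Proof. by move=> f g; apply: linear_eqP => x /=; rewrite addrC. Qed.
Fact lin_add0 : left_id lin_zero lin_add.
Proof. by move=> f; apply: linear_eqP => x /=; rewrite add0r. Qed.
Fact lin_addN : left_inverse lin_zero lin_opp lin_add.
Proof. by move=> f; apply: linear_eqP => x /=; rewrite addNr. Qed.

HB.instance Definition _ :=
  GRing.isZmodule.Build {linear U -> V} lin_addA lin_addC lin_add0 lin_addN.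

Lemma linear_addE f g x : (f + g) x = f x + g x. Proof. by []. Qed.
Lemma linear_zeroE x : (0 : {linear U -> V}) x = 0. Proof. by []. Qed.
Lemma linear_oppE f x : (- f) x = - f x. Proof. by []. Qed.

End LinearMaps.

Definition lin (R : pzRingType) (U V : lmodType R) (f : U -> V)
  (lf : linear f) : {linear U -> V} :=
  HB.pack f (GRing.isLinear.Build R U V *:%R f lf).

Definition is_zero (V : zmodType) := forall x : V, x = 0.

Definition surjective (T U : Type) (f : T -> U) := forall y, exists x, f x = y.

Definition exact_at (T : Type) (V W : zmodType) (f : T -> V) (g : V -> W) :=
  forall y, g y = 0 <-> exists x, f x = y.

Definition precomp (R : pzRingType) (U V W : lmodType R) (f : {linear U -> V})
  (h : {linear V -> W}) : {linear U -> W} := h \o f.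

Definition postcomp (R : pzRingType) (U V W : lmodType R) (f : {linear V -> W})
  (h : {linear U -> V}) : {linear U -> W} := f \o h.

Definition fingen (R : pzRingType) (M : lmodType R) :=
  exists n (g : 'I_n -> M), forall m, exists c : 'I_n -> R,
    m = \sum_(i < n) c i *: g i.

Definition projective (R : pzRingType) (P : lmodType R) :=
  forall (U V : lmodType R) (p : {linear U -> V}) (f : {linear P -> V}),
    surjective p -> exists g : {linear P -> U}, forall x, p (g x) = f x.

Definition noetherian (R : comPzRingType) :=
  forall I : R -> Prop,
    I 0 -> (forall x y, I x -> I y -> I (x + y)) ->
    (forall a x, I x -> I (a * x)) ->
    exists n (g : 'I_n -> R), (forall i, I (g i)) /\
      forall x, I x -> exists c : 'I_n -> R, x = \sum_(i < n) c i * g i.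

(** [X] is isomorphic to a direct summand of some [T^k]. *)
Definition in_add (R : pzRingType) (T X : lmodType R) :=
  exists k (Y : lmodType R) (f : {linear (X * Y)%type -> {ffun 'I_k -> T}}),
    bijective f.

(** Unlike [algType R], this includes the zero algebra. *)
Record algebra (R : comPzRingType) := Algebra {
  alg_ring :> pzRingType;
  alg_str : {rmorphism R -> alg_ring};
  alg_strC : forall r a, alg_str r * a = a * alg_str r }.

Section OppositeAlgebra.
Variables (R : comPzRingType) (A : algebra R).

Definition op_str (r : R) : A^c := alg_str A r.

Fact op_str_zmod : zmod_morphism op_str.
Proof. by move=> r s; rewrite /op_str rmorphB. Qed.
Fact op_str_monoid : monoid_morphism op_str.
Proof.
split=> [|r s]; first exact: (rmorph1 (alg_str A)).
by rewrite /op_str mulrC rmorphM.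
Qed.
HB.instance Definition _ := GRing.isZmodMorphism.Build R A^c op_str op_str_zmod.
HB.instance Definition _ :=
  GRing.isMonoidMorphism.Build R A^c op_str op_str_monoid.

Fact op_strC (r : R) (a : A^c) : op_str r * a = a * op_str r.
Proof. exact: (esym (alg_strC r (a : A))). Qed.

Definition op_alg : algebra R := @Algebra R A^c op_str op_strC.

End OppositeAlgebra.

Section Restriction.
Variables (R : comPzRingType) (A : algebra R) (M : lmodType A).

Definition res : Type := M.
HB.instance Definition _ := GRing.Zmodule.on res.

Definition res_scale (r : R) (m : res) : res := alg_str A r *: (m : M).
Fact res_scaleA a b v : res_scale a (res_scale b v) = res_scale (a * b) v.
Proof. by rewrite /res_scale scalerA rmorphM. Qed.
Fact res_scale1 : left_id 1 res_scale.
Proof. by move=> v; rewrite /res_scale rmorph1 scale1r. Qed.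
Fact res_scaleDr : right_distributive res_scale +%R.
Proof. by move=> a u v; apply: scalerDr. Qed.
Fact res_scaleDl v : {morph res_scale^~ v : a b / a + b}.
Proof. by move=> a b; rewrite /res_scale rmorphD scalerDl. Qed.
HB.instance Definition _ :=
  GRing.Zmodule_isLmodule.Build R res
    res_scaleA res_scale1 res_scaleDr res_scaleDl.

Lemma res_scaleE (r : R) (m : M) : r *: (m : res) = (alg_str A r *: m : M).
Proof. by []. Qed.

End Restriction.

Section HomR.
Variables (R : comPzRingType) (A : algebra R) (M N : lmodType A).

Definition homR : Type := {linear M -> N}.
HB.instance Definition _ := GRing.Zmodule.on homR.

Fact homR_scale_linear (r : R) (f : {linear M -> N}) :
  linear (fun x => alg_str A r *: f x).
Proof.
move=> a x y; rewrite linearP scalerDr !scalerA.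
by congr (_ *: _ + _); apply: alg_strC.
Qed.
Definition homR_scale (r : R) (f : homR) : homR := lin (homR_scale_linear r f).

Fact homR_scaleA a b v : homR_scale a (homR_scale b v) = homR_scale (a * b) v.
Proof. by apply: linear_eqP => x /=; rewrite scalerA rmorphM. Qed.
Fact homR_scale1 : left_id 1 homR_scale.
Proof. by move=> v; apply: linear_eqP => x /=; rewrite rmorph1 scale1r. Qed.
Fact homR_scaleDr : right_distributive homR_scale +%R.
Proof. by move=> a u v; apply: linear_eqP => x /=; apply: scalerDr. Qed.
Fact homR_scaleDl v : {morph homR_scale^~ v : a b / a + b}.
Proof. by move=> a b; apply: linear_eqP => x /=; rewrite rmorphD scalerDl. Qed.
HB.instance Definition _ := GRing.Zmodule_isLmodule.Build R homR
  homR_scaleA homR_scale1 homR_scaleDr homR_scaleDl.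

End HomR.

(** The dual [Hom_R(M, R)], a right [A]-module via [(f a) m = f (a m)]. *)
Section Dual.
Variables (R : comPzRingType) (A : algebra R) (M : lmodType A).

Definition dual : Type := {linear res M -> R^o}.
HB.instance Definition _ := GRing.Zmodule.on dual.

Fact dual_scale_linear (a : A) (f : {linear res M -> R^o}) :
  linear (fun m : res M => f (a *: (m : M) : res M)).
Proof.
move=> r x y /=; rewrite -linearP; congr (f _).
by rewrite /= !res_scaleE scalerDr !scalerA alg_strC.
Qed.
Definition dual_scale (a : op_alg A) (f : dual) : dual :=
  lin (dual_scale_linear a f).

Fact dual_scaleA a b v : dual_scale a (dual_scale b v) = dual_scale (a * b) v.
Proof. by apply: linear_eqP => x /=; rewrite scalerA. Qed.
Fact dual_scale1 : left_id 1 dual_scale.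
Proof. by move=> v; apply: linear_eqP => x /=; rewrite scale1r. Qed.
Fact dual_scaleDr : right_distributive dual_scale +%R.
Proof. by move=> a u v; apply: linear_eqP. Qed.
Fact dual_scaleDl v : {morph dual_scale^~ v : a b / a + b}.
Proof.
by move=> a b; apply: linear_eqP => x /=; rewrite scalerDl (linearD v).
Qed.
HB.instance Definition _ := GRing.Zmodule_isLmodule.Build (op_alg A) dual
  dual_scaleA dual_scale1 dual_scaleDr dual_scaleDl.

Lemma dual_scaleE (a : op_alg A) (f : dual) (m : M) :
  (a *: f : dual) m = f ((a : A) *: m).
Proof. by []. Qed.

End Dual.

Section Endomorphisms.
Variables (A : pzRingType) (Q : lmodType A).

Definition endo : Type := {linear Q -> Q}.
HB.instance Definition _ := GRing.Zmodule.on endo.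

Definition endo_one : endo := (idfun : {linear Q -> Q}).
Definition endo_mul (f g : endo) : endo := postcomp f g.
Fact endo_mulA : associative endo_mul.
Proof. by move=> f g h; apply: linear_eqP. Qed.
Fact endo_mul1l : left_id endo_one endo_mul.
Proof. by move=> f; apply: linear_eqP. Qed.
Fact endo_mul1r : right_id endo_one endo_mul.
Proof. by move=> f; apply: linear_eqP. Qed.
Fact endo_mulDl : left_distributive endo_mul +%R.
Proof. by move=> f g h; apply: linear_eqP. Qed.
Fact endo_mulDr : right_distributive endo_mul +%R.
Proof. by move=> f g h; apply: linear_eqP => x /=; rewrite (linearD f). Qed.
HB.instance Definition _ := GRing.Zmodule_isPzRing.Build endo
  endo_mulA endo_mul1l endo_mul1r endo_mulDl endo_mulDr.

(** The ring [B = End_A(Q)^op]. *)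
Definition endop : pzRingType := endo^c.

End Endomorphisms.

(** [Q] as a right [B]-module: [q b] is the value of [b] at [q]. *)
Section EndModule.
Variables (A : pzRingType) (Q : lmodType A).

Definition emod : Type := Q.
HB.instance Definition _ := GRing.Zmodule.on emod.

Definition emod_scale (b : (endop Q)^c) (q : emod) : emod := (b : endo Q) q.
Fact emod_scaleA a b v : emod_scale a (emod_scale b v) = emod_scale (a * b) v.
Proof. by []. Qed.
Fact emod_scale1 : left_id 1 emod_scale.
Proof. by []. Qed.
Fact emod_scaleDr : right_distributive emod_scale +%R.
Proof. by move=> a u v; apply: (linearD (a : endo Q)). Qed.
Fact emod_scaleDl v : {morph emod_scale^~ v : a b / a + b}.
Proof. by []. Qed.
HB.instance Definition _ := GRing.Zmodule_isLmodule.Build (endop Q)^c emod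
  emod_scaleA emod_scale1 emod_scaleDr emod_scaleDl.

End EndModule.

(** [Hom_A(Q, M)] as a left [B]-module: [b g = g \o b]. *)
Section HomFrom.
Variables (A : pzRingType) (Q M : lmodType A).

Definition homl : Type := {linear Q -> M}.
HB.instance Definition _ := GRing.Zmodule.on homl.

Definition homl_scale (b : endop Q) (g : homl) : homl :=
  precomp (b : endo Q) g.
Fact homl_scaleA a b v : homl_scale a (homl_scale b v) = homl_scale (a * b) v.
Proof. by apply: linear_eqP. Qed.
Fact homl_scale1 : left_id 1 homl_scale.
Proof. by move=> v; apply: linear_eqP. Qed.
Fact homl_scaleDr : right_distributive homl_scale +%R.
Proof. by move=> a u v; apply: linear_eqP. Qed.
Fact homl_scaleDl v : {morph homl_scale^~ v : a b / a + b}.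
Proof. by move=> a b; apply: linear_eqP => x /=; rewrite (linearD v). Qed.
HB.instance Definition _ := GRing.Zmodule_isLmodule.Build (endop Q) homl
  homl_scaleA homl_scale1 homl_scaleDr homl_scaleDl.

End HomFrom.

(** [Hom_A(M, Q)] as a right [B]-module: [f b = b \o f]. *)
Section HomTo.
Variables (A : pzRingType) (M Q : lmodType A).

Definition homr : Type := {linear M -> Q}.
HB.instance Definition _ := GRing.Zmodule.on homr.

Definition homr_scale (b : (endop Q)^c) (f : homr) : homr :=
  postcomp (b : endo Q) f.
Fact homr_scaleA a b v : homr_scale a (homr_scale b v) = homr_scale (a * b) v.
Proof. by apply: linear_eqP. Qed.
Fact homr_scale1 : left_id 1 homr_scale.
Proof. by move=> v; apply: linear_eqP. Qed.
Fact homr_scaleDr : right_distributive homr_scale +%R.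
Proof.
by move=> a u v; apply: linear_eqP => x /=; rewrite (linearD (a : endo Q)).
Qed.
Fact homr_scaleDl v : {morph homr_scale^~ v : a b / a + b}.
Proof. by move=> a b; apply: linear_eqP. Qed.
HB.instance Definition _ := GRing.Zmodule_isLmodule.Build (endop Q)^c homr
  homr_scaleA homr_scale1 homr_scaleDr homr_scaleDl.

End HomTo.

(** [DQ] as a left [B]-module: [b h = h \o b]. *)
Section DualEndModule.
Variables (R : comPzRingType) (A : algebra R) (Q : lmodType A).

Definition edual : Type := dual Q.
HB.instance Definition _ := GRing.Zmodule.on edual.

Fact edual_scale_linear (b : {linear Q -> Q}) (h : {linear res Q -> R^o}) :
  linear (fun q : res Q => h (b q : res Q)).
Proof. by move=> r x y; rewrite -linearP !res_scaleE linearP. Qed.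

Definition edual_scale (b : endop Q) (h : edual) : edual :=
  lin (edual_scale_linear b h).
Fact edual_scaleA a b v :
  edual_scale a (edual_scale b v) = edual_scale (a * b) v.
Proof. by apply: linear_eqP. Qed.
Fact edual_scale1 : left_id 1 edual_scale.
Proof. by move=> v; apply: linear_eqP. Qed.
Fact edual_scaleDr : right_distributive edual_scale +%R.
Proof. by move=> a u v; apply: linear_eqP. Qed.
Fact edual_scaleDl v : {morph edual_scale^~ v : a b / a + b}.
Proof. by move=> a b; apply: linear_eqP => x /=; rewrite (linearD v). Qed.
HB.instance Definition _ := GRing.Zmodule_isLmodule.Build (endop Q) edual
  edual_scaleA edual_scale1 edual_scaleDr edual_scaleDl.

End DualEndModule.

(** [Hom_A(DQ, DM)] as a right [B]-module: [(f b) h = f (b h)]. *)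
Section HomDual.
Variables (R : comPzRingType) (A : algebra R) (Q M : lmodType A).

Definition homD : Type := {linear dual Q -> dual M}.
HB.instance Definition _ := GRing.Zmodule.on homD.

Fact homD_scale_linear (b : endop Q) (f : {linear dual Q -> dual M}) :
  linear (fun h : dual Q => f (b *: (h : edual Q) : edual Q)).
Proof.
move=> a x y; rewrite -linearP; congr (f _); apply: linear_eqP => q /=.
by rewrite (linearZZ (b : {linear Q -> Q})).
Qed.

Definition homD_scale (b : (endop Q)^c) (f : homD) : homD :=
  lin (homD_scale_linear b f).
Fact homD_scaleA a b v : homD_scale a (homD_scale b v) = homD_scale (a * b) v.
Proof. by apply: linear_eqP => h /=; rewrite scalerA. Qed.
Fact homD_scale1 : left_id 1 homD_scale.
Proof. by move=> v; apply: linear_eqP => h /=; rewrite scale1r. Qed.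
Fact homD_scaleDr : right_distributive homD_scale +%R.
Proof. by move=> a u v; apply: linear_eqP. Qed.
Fact homD_scaleDl v : {morph homD_scale^~ v : a b / a + b}.
Proof.
by move=> a b; apply: linear_eqP => h /=; rewrite scalerDl (linearD v).
Qed.
HB.instance Definition _ := GRing.Zmodule_isLmodule.Build (endop Q)^c homD
  homD_scaleA homD_scale1 homD_scaleDr homD_scaleDl.

End HomDual.

Section Kernel.
Variables (R : pzRingType) (U V : lmodType R) (f : {linear U -> V}).

Definition kerp : {pred U} := fun x => f x == 0.
Fact kerp_closed : subsemimod_closed kerp.
Proof.
split; first split; rewrite ?unfold_in /kerp /= ?linear0 //.
  move=> x y; rewrite !unfold_in /kerp => /eqP fx /eqP fy.
  by rewrite linearD fx fy addr0.
by move=> a x; rewrite !unfold_in /kerp => /eqP fx; rewrite linearZZ fx scaler0.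
Qed.
HB.instance Definition _ := GRing.isSubmodClosed.Build R U kerp kerp_closed.

Record ker : Type := Ker { ker_val : U; _ : ker_val \in kerp }.
HB.instance Definition _ := [isSub for ker_val].
HB.instance Definition _ := [Choice of ker by <:].
HB.instance Definition _ := [SubChoice_isSubLmodule of ker by <:].

Fact ker_val_linear : linear ker_val.
Proof. by []. Qed.
Definition ker_incl : {linear ker -> U} := lin ker_val_linear.

End Kernel.

(** The free [R]-module on the set [X]: finitely supported functions. *)
Section FreeModule.
Variables (R : pzRingType) (X : choiceType).

Definition finsupp : {pred X -> R^o} :=
  fun f => `[< exists s : seq X, forall x, f x != 0 -> x \in s >].
Fact finsupp_closed : subsemimod_closed finsupp.
Proof.
split; first split.
- by apply/asboolP; exists [::] => x; rewrite eqxx.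
- move=> f g /asboolP[s sP] /asboolP[t tP]; apply/asboolP; exists (s ++ t) => x.
  rewrite mem_cat; apply: contraNT; rewrite negb_or => /andP[xs xt].
  have /eqP fx : f x == 0 by apply: contraNT xs; apply: sP.
  have /eqP gx : g x == 0 by apply: contraNT xt; apply: tP.
  by rewrite [(f + g) x]/GRing.add /= fx gx addr0.
- move=> a f /asboolP[s sP]; apply/asboolP; exists s => x.
  apply: contraNT => xs; have /eqP fx : f x == 0.
    by apply: contraNT xs; apply: sP.
  by rewrite [(a *: f) x]/GRing.scale /= fx scaler0.
Qed.
HB.instance Definition _ :=
  GRing.isSubmodClosed.Build R (X -> R^o) finsupp finsupp_closed.

Record free_mod : Type := Free { fcoef : X -> R^o; _ : fcoef \in finsupp }.
HB.instance Definition _ := [isSub for fcoef].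
HB.instance Definition _ := [Choice of free_mod by <:].
HB.instance Definition _ := [SubChoice_isSubLmodule of free_mod by <:].

Definition coef (u : free_mod) (x : X) : R := fcoef u x.

Fact fgen_subproof (x : X) :
  (fun y => if y == x then 1 else 0 : R^o) \in finsupp.
Proof.
apply/asboolP; exists [:: x] => y; rewrite inE.
by case: (y == x) => //; rewrite eqxx.
Qed.
Definition fgen (x : X) : free_mod := Free (fgen_subproof x).

Section Lift.
Variables (V : lmodType R) (f : X -> V).

Definition flift_fun (u : free_mod) : V := \sum_(x \in setT) coef u x *: f x.

Lemma flift_funE (u : free_mod) (s : seq X) : uniq s ->
  (forall x, coef u x != 0 -> x \in s) ->
  flift_fun u = \sum_(x <- s) coef u x *: f x.
Proof.
move=> us uP; rewrite /flift_fun fsbig_supp; apply: fsbig_fwiden => //.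
- move=> x [_ /= /eqP ux]; apply: uP; apply: contraNneq ux => ->.
  by rewrite scale0r.
- by move=> x [/= xs /not_andP[|]//]; rewrite /= => /contrapT.
Qed.

Lemma finsuppP (u v : free_mod) : exists s : seq X, uniq s /\
  forall x, (coef u x != 0 -> x \in s) /\ (coef v x != 0 -> x \in s).
Proof.
case: u v => [u /asboolP[s sP]] [v /asboolP[t tP]] /=.
exists (undup (s ++ t)); split=> [|x]; first exact: undup_uniq.
by rewrite mem_undup mem_cat; split=> [/sP|/tP] ->; rewrite ?orbT.
Qed.

Fact flift_linear : linear flift_fun.
Proof.
move=> a u v; have [s [us sP]] := finsuppP u v.
rewrite (@flift_funE u s) //; last by move=> x /(proj1 (sP x)).
rewrite (@flift_funE v s) //; last by move=> x /(proj2 (sP x)).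
have E x : coef (a *: u + v) x = a * coef u x + coef v x by [].
rewrite (@flift_funE _ s) //; last first.
  move=> x; rewrite E; apply: contraNT => xs.
  have /eqP ux : coef u x == 0 by apply: contraNT xs => /(proj1 (sP x)).
  have /eqP vx : coef v x == 0 by apply: contraNT xs => /(proj2 (sP x)).
  by rewrite ux vx mulr0 addr0.
rewrite scaler_sumr -big_split; apply: eq_bigr => x _.
by rewrite E scalerDl scalerA.
Qed.
Definition flift : {linear free_mod -> V} := lin flift_linear.

Lemma flift_gen x : flift (fgen x) = f x.
Proof.
rewrite /flift /= (@flift_funE _ [:: x]) //=; last first.
  by move=> y; rewrite inE; case: (y == x) => //; rewrite eqxx.
by rewrite big_seq1 eqxx scale1r.
Qed.

End Lift.

Lemma free_sum (u : free_mod) : u = flift fgen u.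
Proof.
have [s [us sP]] := finsuppP u u.
rewrite /flift /= (@flift_funE _ _ _ s) //; last by move=> x /(proj1 (sP x)).
apply: val_inj => /=; apply/funext => y; rewrite -!/(coef _ y).
have E : forall (r : seq X) (F : X -> free_mod),
    coef (\sum_(x <- r) F x) y = \sum_(x <- r) coef (F x) y.
  by move=> r F; elim/big_rec2: _ => // x a b _ <-.
rewrite E; have Ex x : coef (coef u x *: fgen x) y =
    coef u x * (if y == x then 1 else 0) by [].
under eq_bigr do rewrite Ex.
have [ys|ys] := boolP (y \in s).
  rewrite (bigD1_seq y) //= eqxx mulr1 big1 ?addr0 // => x.
  by rewrite eq_sym => /negPf ->; rewrite mulr0.
rewrite big_seq big1.
  by apply/eqP; apply: contraNT ys => /(proj1 (sP y)).
move=> x xs; case: eqP => [yx|_]; last by rewrite mulr0.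
by rewrite yx xs in ys.
Qed.

End FreeModule.

Arguments fgen {R X} x.

Definition addm (U V : zmodType) (f : U -> V) (hf : zmod_morphism f) :
  {additive U -> V} := HB.pack f (GRing.isZmodMorphism.Build U V f hf).

(** [tens X N] is the free abelian group on [X * N] modulo the subgroup
  [tensor_rel] generated by the bilinear, [B]-balanced relations. *)
Section Tensor.
Variables (B : pzRingType) (X : lmodType B^c) (N : lmodType B).

Let F := free_mod int (X * N)%type.

Inductive tensor_rel : F -> Prop :=
| tensor_rel0 : tensor_rel 0
| tensor_relB u v : tensor_rel u -> tensor_rel v -> tensor_rel (u - v)
| tensor_relDl x y n :
    tensor_rel (fgen (x + y, n) - (fgen (x, n) + fgen (y, n)))
| tensor_relDr x m n :
    tensor_rel (fgen (x, m + n) - (fgen (x, m) + fgen (x, n)))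
| tensor_relZ (b : B) x n :
    tensor_rel (fgen ((b : B^c) *: x, n) - fgen (x, b *: n)).

Definition tensor_relp : {pred F} := fun u => `[< tensor_rel u >].
Fact tensor_relp_closed : zmod_closed tensor_relp.
Proof.
split; first exact/asboolP/tensor_rel0.
by move=> u v /asboolP hu /asboolP hv; apply/asboolP/tensor_relB.
Qed.
HB.instance Definition _ := GRing.isZmodClosed.Build F tensor_relp
  tensor_relp_closed.

Definition tens : Type := Quotient.quot tensor_relp.
HB.instance Definition _ := GRing.Zmodule.on tens.

Definition tens_pi (u : F) : tens := (\pi_(Quotient.quot tensor_relp) u)%qT.
Definition tmul (x : X) (n : N) : tens := tens_pi (fgen (x, n)).

Lemma tens_piB u v : tens_pi (u - v) = tens_pi u - tens_pi v.
Proof. exact: (raddfB (\pi_(Quotient.quot tensor_relp))%qT). Qed.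
Lemma tens_piD u v : tens_pi (u + v) = tens_pi u + tens_pi v.
Proof. exact: (raddfD (\pi_(Quotient.quot tensor_relp))%qT). Qed.

Lemma tens_pi_eq u v : tens_pi u = tens_pi v <-> tensor_rel (u - v).
Proof.
rewrite /tens_pi; split=> [/eqP|uv]; first by rewrite -Quotient.idealrBE => /asboolP.
by apply/eqP; rewrite -Quotient.idealrBE; apply/asboolP.
Qed.

Lemma tmulDl x y n : tmul (x + y) n = tmul x n + tmul y n.
Proof. by rewrite /tmul -tens_piD; apply/tens_pi_eq/tensor_relDl. Qed.
Lemma tmulDr x m n : tmul x (m + n) = tmul x m + tmul x n.
Proof. by rewrite /tmul -tens_piD; apply/tens_pi_eq/tensor_relDr. Qed.
Lemma tmulZ (b : B) x n : tmul ((b : B^c) *: x) n = tmul x (b *: n).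
Proof. exact/tens_pi_eq/tensor_relZ. Qed.

Section Lift.
Variables (G : zmodType) (beta : X -> N -> G).
Hypotheses
  (betaDl : forall x y n, beta (x + y) n = beta x n + beta y n)
  (betaDr : forall x m n, beta x (m + n) = beta x m + beta x n)
  (betaZ : forall (b : B) x n, beta ((b : B^c) *: x) n = beta x (b *: n)).

Let lift0 : {linear F -> zmodule G} :=
  flift (fun p : (X * N)%type => beta p.1 p.2 : zmodule G).

Let lift0_rel u : tensor_rel u -> lift0 u = 0.
Proof.
elim=> [|||x m n|b x n]; rewrite ?linear0 //.
- by move=> v w _ v0 _ w0; rewrite linearB v0 w0 subr0.
- by move=> x y n; rewrite linearB linearD !flift_gen /= betaDl subrr.
- by rewrite linearB linearD !flift_gen /= betaDr subrr.
- by rewrite linearB !flift_gen /= betaZ subrr.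
Qed.

Let tlift_fun (t : tens) : G :=
  lift0 (repr (t : Quotient.quot tensor_relp)).

Let tlift_pi u : tlift_fun (tens_pi u) = lift0 u.
Proof.
apply/eqP; rewrite -subr_eq0; apply/eqP; rewrite -[LHS](linearB lift0).
by apply: lift0_rel; apply/tens_pi_eq; rewrite /tens_pi reprK.
Qed.

Let tens_piP t : exists u, t = tens_pi u.
Proof.
by exists (repr (t : Quotient.quot tensor_relp)); rewrite /tens_pi reprK.
Qed.

Let tlift_zmod : zmod_morphism tlift_fun.
Proof.
move=> t s; have [u ->] := tens_piP t; have [v ->] := tens_piP s.
by rewrite -tens_piB !tlift_pi [LHS](linearB lift0).
Qed.

Lemma tlift_sig :
  {f : {additive tens -> G} | forall x n, f (tmul x n) = beta x n}.
Proof.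
by exists (addm tlift_zmod) => x n; rewrite /= tlift_pi [LHS]flift_gen.
Qed.
Definition tlift : {additive tens -> G} := sval tlift_sig.

Lemma tliftE x n : tlift (tmul x n) = beta x n.
Proof. exact: (svalP tlift_sig). Qed.

End Lift.

Lemma tens_ext (G : zmodType) (f g : {additive tens -> G}) :
  (forall x n, f (tmul x n) = g (tmul x n)) -> f =1 g.
Proof.
move=> fg t; have -> : t = tens_pi (repr (t : Quotient.quot tensor_relp)).
  by rewrite /tens_pi reprK.
move: (repr _) => u; rewrite (free_sum u) /flift /=.
have [s [us sP]] := finsuppP u u.
rewrite (@flift_funE _ _ _ _ _ s) //; last by move=> x /(proj1 (sP x)).
have E : forall h : {additive tens -> G},
    h (tens_pi (\sum_(p <- s) coef u p *: fgen p)) =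
    \sum_(p <- s) h (tens_pi (fgen p)) *~ coef u p.
  move=> h; elim: s {us sP} => [|p s IHs].
    rewrite !big_nil (_ : tens_pi 0 = 0) ?raddf0 //.
    exact: (raddf0 (\pi_(Quotient.quot tensor_relp))%qT).
  rewrite !big_cons tens_piD raddfD IHs; congr (_ + _).
  have : forall c : int, tens_pi (c *: fgen p) = tens_pi (fgen p) *~ c.
    move=> c; have -> : c *: fgen p = fgen p *~ c by rewrite -scaler_int intz.
    exact: (raddfMz (\pi_(Quotient.quot tensor_relp))%qT).
  by move=> ->; rewrite raddfMz.
by rewrite !E; apply: eq_bigr => -[x n] _; rewrite [h in h *~ _]fg.
Qed.

End Tensor.

Section TensorMap.
Variables (B : pzRingType) (X X' : lmodType B^c) (N N' : lmodType B).
Variables (phi : {linear X -> X'}) (psi : {linear N -> N'}).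

Definition tens_map : {additive tens X N -> tens X' N'}.
Proof.
refine (@tlift B X N (tens X' N') (fun x n => tmul (phi x) (psi n)) _ _ _).
- by move=> x y n; rewrite linearD tmulDl.
- by move=> x m n; rewrite linearD tmulDr.
- by move=> b x n; rewrite !linearZZ tmulZ.
Defined.

Lemma tens_mapE x n : tens_map (tmul x n) = tmul (phi x) (psi n).
Proof. exact: tliftE. Qed.

End TensorMap.

(** [ker g / im f], for [f] and [g] with [g \o f = 0]. *)
Section Homology.
Variables (U V W : zmodType) (f : {additive U -> V}) (g : {additive V -> W}).

Definition zkerp : {pred V} := fun x => g x == 0.
Fact zkerp_closed : zmod_closed zkerp.
Proof.
split=> [|x y]; rewrite !unfold_in /zkerp ?raddf0 //.
by move=> /eqP gx /eqP gy; rewrite raddfB gx gy subr0.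
Qed.
HB.instance Definition _ := GRing.isZmodClosed.Build V zkerp zkerp_closed.

Record cycle : Type := Cycle { cycle_val : V; _ : cycle_val \in zkerp }.
HB.instance Definition _ := [isSub for cycle_val].
HB.instance Definition _ := [Choice of cycle by <:].
HB.instance Definition _ := [SubChoice_isSubZmodule of cycle by <:].

Definition boundaryp : {pred cycle} := fun z => `[< exists u, f u = val z >].
Fact boundaryp_closed : zmod_closed boundaryp.
Proof.
split=> [|x y]; first by apply/asboolP; exists 0; rewrite raddf0.
move=> /asboolP[u fu] /asboolP[v fv]; apply/asboolP; exists (u - v).
by rewrite raddfB fu fv.
Qed.
HB.instance Definition _ := GRing.isZmodClosed.Build cycle boundaryp
  boundaryp_closed.

Definition homology : zmodType := Quotient.quot boundaryp.

End Homology.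

(** The standard free resolution of [N]: [P_i] is the free module on the
  underlying set of the [i]-th syzygy [K_i], where [K_0 = N] and [K_(i+1)] is
  the kernel of the canonical surjection [P_i -> K_i]. *)
Section Tor.
Variables (B : pzRingType).

Definition cover (N : lmodType B) : {linear free_mod B N -> N} := flift id.

Fixpoint syzygy (N : lmodType B) (i : nat) : lmodType B :=
  if i is j.+1 then ker (cover (syzygy N j)) else N.

Definition resol (N : lmodType B) (i : nat) : lmodType B :=
  free_mod B (syzygy N i).

Definition resol_d (N : lmodType B) (i : nat) :
    {linear resol N i.+1 -> resol N i} :=
  @ker_incl B (resol N i) (syzygy N i) (cover (syzygy N i))
    \o cover (syzygy N i.+1).

Definition tens_d (X : lmodType B^c) (N : lmodType B) (i : nat) :
    {additive tens X (resol N i.+1) -> tens X (resol N i)} :=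
  tens_map idfun (resol_d N i).

Definition Tor (i : nat) (X : lmodType B^c) (N : lmodType B) : zmodType :=
  match i with
  | 0 => homology (tens_d X N 0)
           (\0 : {additive tens X (resol N 0) -> tens X (resol N 0)})
  | j.+1 => homology (tens_d X N j.+1) (tens_d X N j)
  end.

End Tor.

(** [Q (x)_B Hom_A(Q, M)] as a left [A]-module, via [a (q (x) g) = a q (x) g]. *)
Section ChiLeft.
Variables (A : pzRingType) (Q M : lmodType A).

Definition tensl : Type := tens (emod Q) (homl Q M).
HB.instance Definition _ := GRing.Zmodule.on tensl.

Fact emod_act_linear (a : A) :
  linear (fun q : emod Q => a *: (q : Q) : emod Q).
Proof.
move=> b x y; rewrite [LHS]scalerDr; congr (_ + _).
exact: (esym (linearZZ (b : {linear Q -> Q}) a x)).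
Qed.
Definition emod_act (a : A) : {linear emod Q -> emod Q} :=
  lin (emod_act_linear a).

Definition tensl_scale (a : A) (t : tensl) : tensl :=
  tens_map (emod_act a) (idfun : {linear homl Q M -> homl Q M}) t.

Fact tensl_scaleA a b v :
  tensl_scale a (tensl_scale b v) = tensl_scale (a * b) v.
Proof.
move: v; apply: (@tens_ext _ _ _ _ (tens_map (emod_act a) idfun \o
  tens_map (emod_act b) idfun) (tens_map _ _)) => x n.
by rewrite /= !tens_mapE /= scalerA.
Qed.
Fact tensl_scale1 : left_id 1 tensl_scale.
Proof.
move=> v; move: v; apply: (@tens_ext _ _ _ _ (tens_map _ _) idfun) => x n.
by rewrite /= !tens_mapE /= scale1r.
Qed.
Fact tensl_scaleDr : right_distributive tensl_scale +%R.
Proof. by move=> a u v; apply: raddfD. Qed.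
Fact tensl_scaleDl v : {morph tensl_scale^~ v : a b / a + b}.
Proof.
move=> a b; move: v; apply: (@tens_ext _ _ _ _ (tens_map _ _)
  (tens_map (emod_act a) idfun \+ tens_map (emod_act b) idfun)) => x n.
by rewrite /= !tens_mapE /= scalerDl [LHS]tmulDl.
Qed.
HB.instance Definition _ := GRing.Zmodule_isLmodule.Build A tensl
  tensl_scaleA tensl_scale1 tensl_scaleDr tensl_scaleDl.

Definition chi_fun : {additive tens (emod Q) (homl Q M) -> M}.
Proof.
refine (@tlift _ (emod Q) (homl Q M) M
  (fun q g => (g : {linear Q -> M}) (q : Q)) _ _ _).
- by move=> x y n; apply: (linearD (n : {linear Q -> M})).
- by [].
- by [].
Defined.

Fact chi_linear : linear (chi_fun : tensl -> M).
Proof.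
move=> a u v; rewrite [LHS](raddfD chi_fun); congr (_ + _).
move: u; apply: (@tens_ext _ _ _ _ (chi_fun \o tens_map (emod_act a) idfun)
  ((a \*: idfun) \o chi_fun)) => x n.
by rewrite /= tens_mapE !tliftE (linearZZ (n : {linear Q -> M})).
Qed.
Definition chi : {linear tensl -> M} := lin chi_linear.

Lemma chiE (q : Q) (g : {linear Q -> M}) :
  chi (tmul (q : emod Q) (g : homl Q M)) = g q.
Proof. by rewrite /chi /= tliftE. Qed.

End ChiLeft.

(** [Hom_A(DQ, DM) (x)_B DQ] as a right [A]-module, via
  [(f (x) h) a = f (x) h a]. *)
Section ChiRight.
Variables (R : comPzRingType) (A : algebra R) (Q M : lmodType A).

Definition tensr : Type := tens (homD Q M) (edual Q).
HB.instance Definition _ := GRing.Zmodule.on tensr.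

Fact edual_act_linear (a : op_alg A) :
  linear (fun h : edual Q => a *: (h : dual Q) : edual Q).
Proof.
move=> b x y; rewrite [LHS]scalerDr; congr (_ + _).
apply: linear_eqP => q /=; congr (x _).
exact: (linearZZ (b : {linear Q -> Q})).
Qed.
Definition edual_act (a : op_alg A) : {linear edual Q -> edual Q} :=
  lin (edual_act_linear a).

Definition tensr_scale (a : op_alg A) (t : tensr) : tensr :=
  tens_map (idfun : {linear homD Q M -> homD Q M}) (edual_act a) t.

Fact tensr_scaleA a b v :
  tensr_scale a (tensr_scale b v) = tensr_scale (a * b) v.
Proof.
move: v; apply: (@tens_ext _ _ _ _ (tens_map idfun (edual_act a) \o
  tens_map idfun (edual_act b)) (tens_map _ _)) => x n.
by rewrite /= !tens_mapE /= scalerA.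
Qed.
Fact tensr_scale1 : left_id 1 tensr_scale.
Proof.
move=> v; move: v; apply: (@tens_ext _ _ _ _ (tens_map _ _) idfun) => x n.
by rewrite /= !tens_mapE /= scale1r.
Qed.
Fact tensr_scaleDr : right_distributive tensr_scale +%R.
Proof. by move=> a u v; apply: raddfD. Qed.
Fact tensr_scaleDl v : {morph tensr_scale^~ v : a b / a + b}.
Proof.
move=> a b; move: v; apply: (@tens_ext _ _ _ _ (tens_map _ _)
  (tens_map idfun (edual_act a) \+ tens_map idfun (edual_act b))) => x n.
by rewrite /= !tens_mapE /= scalerDl [LHS]tmulDr.
Qed.
HB.instance Definition _ := GRing.Zmodule_isLmodule.Build (op_alg A) tensr
  tensr_scaleA tensr_scale1 tensr_scaleDr tensr_scaleDl.

Definition chir_fun : {additive tens (homD Q M) (edual Q) -> dual M}.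
Proof.
refine (@tlift _ (homD Q M) (edual Q) (dual M)
  (fun f h => (f : {linear dual Q -> dual M}) (h : dual Q)) _ _ _).
- by [].
- by move=> f x y; apply: (linearD (f : {linear dual Q -> dual M})).
- by [].
Defined.

Fact chir_linear : linear (chir_fun : tensr -> dual M).
Proof.
move=> a u v; rewrite [LHS](raddfD chir_fun); congr (_ + _).
move: u; apply: (@tens_ext _ _ _ _ (chir_fun \o tens_map idfun (edual_act a))
  ((a \*: idfun) \o chir_fun)) => f h.
by rewrite /= tens_mapE !tliftE (linearZZ (f : {linear dual Q -> dual M})).
Qed.
Definition chir : {linear tensr -> dual M} := lin chir_linear.

Lemma chirE (f : {linear dual Q -> dual M}) (h : dual Q) :
  chir (tmul (f : homD Q M) (h : edual Q)) = f h.
Proof. by rewrite /chir /= tliftE. Qed.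

End ChiRight.

(** [None] stands for [+oo]. *)
Definition natbar := option nat.

Definition natbar_ge (d : natbar) (n : nat) : bool :=
  if d is Some m then (n <= m)%N else true.

Definition upper_bound (S : nat -> Prop) (b : nat) : bool :=
  `[< forall n, S n -> (n <= b)%N >].

Definition natbar_sup (S : nat -> Prop) : natbar :=
  match pselect (exists b, upper_bound S b) with
  | left Sb => Some (ex_minn Sb)
  | right _ => None
  end.

Section RelativeDimension.
Variables (R : comPzRingType) (A : algebra R).
Implicit Types T X M N Y : lmodType A.

Definition fg_proj_alg := fingen (res A^o) /\ projective (res A^o).

Definition mod_proj M := [/\ fingen M, fingen (res M) & projective (res M)].

(** Equivalently, both [0 -> ker f -> M -> im f -> 0] and
  [0 -> im f -> N -> coker f -> 0] split over [R]. A complex is split when this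
  holds for each of its maps, the outermost one included: the sequence
  [0 -> M -> N] is then split exact iff [M -> N] is split injective over [R]. *)
Definition rsplit M N (f : {linear M -> N}) :=
  exists s : {linear res N -> res M}, forall x : M, f (s (f x)) = f x.

Definition rel_mono M N (f : {linear M -> N}) :=
  exists s : {linear res N -> res M}, forall x : M, s (f x) = x.

Definition left_approx T X N (f : {linear X -> N}) :=
  in_add T N /\ forall Y, in_add T Y -> surjective (@precomp A X N Y f).

Definition right_approx T X N (f : {linear N -> X}) :=
  in_add T N /\ forall Y, in_add T Y -> surjective (@postcomp A Y N X f).

(** The modules [T_1, T_2, ...] preceded by [X]; [T_(i+1)] is [C i]. *)
Definition aug X (C : nat -> lmodType A) (i : nat) : lmodType A :=
  if i is j.+1 then C j else X.

(** [(A, R)]-exact sequences [0 -> X -> T_1 -> ... -> T_n] that remain exact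
  under [Hom_A(-, T)]; [C i] for [i >= n] and [d i] for [i >= n] are junk. *)
Definition coresolution T X (n : nat) :=
  exists (C : nat -> lmodType A)
         (d : forall i, {linear aug X C i -> aug X C i.+1}),
    [/\ forall i, (i < n)%N -> in_add T (C i),
        injective (d 0) /\
          (forall i, (i.+1 < n)%N -> exact_at (d i) (d i.+1)),
        forall i, (i < n)%N -> rsplit (d i) &
        surjective (@precomp A _ _ T (d 0)) /\
          (forall i, (i.+1 < n)%N ->
             exact_at (@precomp A _ _ T (d i.+1)) (@precomp A _ _ T (d i)))].

(** Dually, sequences [T_n -> ... -> T_1 -> X -> 0] and [Hom_A(T, -)]. *)
Definition resolution T X (n : nat) :=
  exists (C : nat -> lmodType A)
         (d : forall i, {linear aug X C i.+1 -> aug X C i}),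
    [/\ forall i, (i < n)%N -> in_add T (C i),
        surjective (d 0) /\
          (forall i, (i.+1 < n)%N -> exact_at (d i.+1) (d i)),
        forall i, (i < n)%N -> rsplit (d i) &
        surjective (@postcomp A T _ _ (d 0)) /\
          (forall i, (i.+1 < n)%N ->
             exact_at (@postcomp A T _ _ (d i.+1)) (@postcomp A T _ _ (d i)))].

(** Leaving out [n = 0] does not affect the supremum: that of [set0] is [0]. *)
Definition domdim T X : natbar :=
  if `[< exists N (f : {linear X -> N}), left_approx T f /\ rel_mono f >]
  then natbar_sup (fun n => (0 < n)%N /\ coresolution T X n) else Some 0%N.

Definition codomdim T X : natbar :=
  if `[< exists N (f : {linear N -> X}), right_approx T f /\ surjective f >]
  then natbar_sup (fun n => (0 < n)%N /\ resolution T X n) else Some 0%N.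

End RelativeDimension.

(* Main.v *)
From HB Require Import structures.
From mathcomp Require Import all_boot all_algebra.
From mathcomp Require Import boolp.
Require Import Defs.

(** The functor [Hom_A(Q, -)] is left exact, the functor [Q (x)_B -] is right
  exact, and the counit [chi] between their composite and the identity is
  bijective on [add Q] (chi_add_bij): if the identity of [T] is a finite sum of
  maps [T -> Q -> T], these maps give both the inverse of [chi] and a finite
  dual basis of [Hom_A(Q, T)] over [B].

  Part (i) is an induction on [n]. A resolution of [M] consists of an
  approximation [T -> M] by a module of [add Q], surjective and surjective under
  [Hom_A(Q, -)], and of a resolution of its kernel [K] (resolutionS); the
  splittings over [R] come for free because all modules are projective over [R].
  Comparing [Q (x) Hom_A(Q, -)] of [K -> T -> M] with [K -> T -> M] itself shows
  that [chi] is surjective at [K] exactly when it is injective at [M], and that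
  its kernel at [K] is [Tor_1(Q, Hom_A(Q, M))]. Dimension shifting handles the
  other Tor groups (chi_step). The induction starts with resolutions of length
  one, which exist exactly when [chi] is surjective: [R] being Noetherian,
  [Hom_A(Q, M)] is finitely generated, and its generators define a map from a
  power of [Q] to [M] whose image is that of [chi] (chi_surj_approx). In
  positive degree, vanishing of Tor is expressed by injectivity of
  [X (x) K -> X (x) P] for a syzygy [K] in [P] (Tor_zeroP); it does not depend
  on the presentations by a version of Schanuel's lemma (stable_retract_lift).

  Part (ii) is the same induction applied to cokernels of approximations
  [M -> T] that split over [R], the contravariant functor [Hom_A(-, Q)], and the
  map [Hom_A(M, Q) (x)_B DQ -> DM] sending [f (x) h] to [h \o f]
  (chi_dual_step). Here the presentation is one of the first argument of Tor,
  while Tor is computed by resolving the second, so [Tor_1] has to be balanced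
  (tor1_zero_sesl), which rests on the flatness of free modules and of modules
  with a finite dual basis. Finally, [Q] is reflexive over [R], so that
  [f |-> D f] identifies [Hom_A(M, Q)] with [Hom_A(DQ, DM)], the map above with
  [chir], and the corresponding Tor groups. *)

Set Implicit Arguments.
Unset Strict Implicit.
Unset Printing Implicit Defensive.

Import GRing.Theory.
Local Open Scope ring_scope.

(** * Quotient groups and right exactness of the tensor product *)

Lemma bijectiveP (T U : Type) (f : T -> U) :
  bijective f <-> injective f /\ surjective f.
Proof.
split=> [[g fK gK]|[fI fS]].
  by split=> [|y]; [exact: can_inj fK | exists (g y); apply: gK].
have [g gK] := choice fS.
by exists g => // x; apply: fI; rewrite gK.
Qed.

Lemma additive_injP (U V : zmodType) (f : {additive U -> V}) :
  injective f <-> forall x, f x = 0 -> x = 0.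
Proof.
split=> [fI x fx|f0 x y fxy]; first by apply: fI; rewrite fx raddf0.
by apply/eqP; rewrite -subr_eq0; apply/eqP/f0; rewrite raddfB fxy subrr.
Qed.

(** A subgroup of [V], given by a predicate with values in [Prop]. *)
Record subgroup (V : zmodType) := Subgroup {
  sg_mem :> V -> Prop;
  sg_mem0 : sg_mem 0;
  sg_memB : forall u v, sg_mem u -> sg_mem v -> sg_mem (u - v) }.

Section QuotientGroup.
Variables (V : zmodType) (S : subgroup V).

Definition sgp : {pred V} := fun v => `[< S v >].
Fact sgp_closed : zmod_closed sgp.
Proof.
split=> [|u v]; first exact/asboolP/sg_mem0.
by move=> /asboolP Su /asboolP Sv; apply/asboolP/sg_memB.
Qed.
HB.instance Definition _ := GRing.isZmodClosed.Build V sgp sgp_closed.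

(** The quotient group [V / S]. *)
Definition quot : Type := Quotient.quot sgp.
HB.instance Definition _ := GRing.Zmodule.on quot.

Definition qpi (v : V) : quot := (\pi_(Quotient.quot sgp) v)%qT.
Definition qrepr (q : quot) : V := repr (q : Quotient.quot sgp).

Lemma qreprK q : qpi (qrepr q) = q. Proof. exact: reprK. Qed.
Lemma qpiB u v : qpi (u - v) = qpi u - qpi v.
Proof. exact: (raddfB (\pi_(Quotient.quot sgp))%qT). Qed.
Lemma qpiD u v : qpi (u + v) = qpi u + qpi v.
Proof. exact: (raddfD (\pi_(Quotient.quot sgp))%qT). Qed.
Lemma qpi_eq u v : qpi u = qpi v <-> S (u - v).
Proof.
rewrite /qpi; split=> [/eqP|uv].
  by rewrite -Quotient.idealrBE => /asboolP.
by apply/eqP; rewrite -Quotient.idealrBE; apply/asboolP.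
Qed.
Lemma qpi_eq0 u : qpi u = 0 <-> S u.
Proof.
have <- : qpi 0 = 0 by exact: (raddf0 (\pi_(Quotient.quot sgp))%qT).
by rewrite qpi_eq subr0.
Qed.

End QuotientGroup.

Section TensorKernel.
Variables (B : pzRingType) (X X' : lmodType B^c) (N N' : lmodType B).

Lemma tens_ind (S : subgroup (tens X N)) :
  (forall x n, S (tmul x n)) -> forall t, S t.
Proof.
move=> St t; apply/qpi_eq0.
apply: (@tens_ext _ _ _ (quot S) (addm (@qpiB _ S)) \0) => x n /=.
exact/qpi_eq0.
Qed.

Lemma tmul0l (n : N) : tmul (0 : X) n = 0.
Proof. by apply: (addrI (tmul 0 n)); rewrite -tmulDl !addr0. Qed.
Lemma tmul0r (x : X) : tmul x (0 : N) = 0.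
Proof. by apply: (addrI (tmul x 0)); rewrite -tmulDr !addr0. Qed.
Lemma tmulNl (x : X) (n : N) : tmul (- x) n = - tmul x n.
Proof. by apply: (addrI (tmul x n)); rewrite -tmulDl !subrr tmul0l. Qed.
Lemma tmulNr (x : X) (n : N) : tmul x (- n) = - tmul x n.
Proof. by apply: (addrI (tmul x n)); rewrite -tmulDr !subrr tmul0r. Qed.
Lemma tmul_suml I (r : seq I) (F : I -> X) (n : N) :
  tmul (\sum_(i <- r) F i) n = \sum_(i <- r) tmul (F i) n.
Proof.
elim: r => [|i r IHr]; first by rewrite !big_nil tmul0l.
by rewrite !big_cons tmulDl IHr.
Qed.
Lemma tmul_sumr I (r : seq I) (F : I -> N) (x : X) :
  tmul x (\sum_(i <- r) F i) = \sum_(i <- r) tmul x (F i).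
Proof.
elim: r => [|i r IHr]; first by rewrite !big_nil tmul0r.
by rewrite !big_cons tmulDr IHr.
Qed.

Variables (phi : {linear X -> X'}) (psi : {linear N -> N'}).
Hypotheses (phiS : surjective phi) (psiS : surjective psi).

(** The kernel of [phi (x) psi] is generated by the [x (x) n] with [phi x = 0]
  or [psi n = 0]: lifting along [phi] and [psi] defines a map from the target of
  [phi (x) psi] to [tens X N / S]. *)
Lemma tens_map_ker (S : subgroup (tens X N)) :
    (forall x n, phi x = 0 -> S (tmul x n)) ->
    (forall x n, psi n = 0 -> S (tmul x n)) ->
  forall t, tens_map phi psi t = 0 -> S t.
Proof.
move=> Sl Sr; have [s sK] := choice phiS; have [r rK] := choice psiS.
have E x y n m : phi x = phi y -> psi n = psi m ->
    qpi S (tmul x n) = qpi S (tmul y m).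
  move=> xy nm.
  have -> : tmul x n = tmul (x - y) n + (tmul y (n - m) + tmul y m).
    by rewrite -tmulDr subrK -tmulDl subrK.
  rewrite !qpiD (proj2 (qpi_eq0 _ _)) ?add0r; last first.
    by apply: Sl; rewrite linearB xy subrr.
  rewrite (proj2 (qpi_eq0 _ _)) ?add0r //.
  by apply: Sr; rewrite linearB nm subrr.
pose beta x' n' := qpi S (tmul (s x') (r n')).
have [||| g gE] := @tlift_sig B X' N' (quot S) beta.
- move=> x y n; rewrite /beta -qpiD -tmulDl; apply: E => //.
  by rewrite linearD !sK.
- move=> x m n; rewrite /beta -qpiD -tmulDr; apply: E => //.
  by rewrite linearD !rK.
- move=> b x n; rewrite /beta.
  rewrite (E _ ((b : B^c) *: s x) _ (r n)) ?linearZZ ?sK //.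
  by rewrite tmulZ; apply: E; rewrite ?linearZZ ?rK.
move=> t t0; apply/qpi_eq0.
transitivity (g (tens_map phi psi t)); last by rewrite t0 raddf0.
apply: (@tens_ext _ _ _ (quot S) (addm (@qpiB _ S)) (g \o tens_map phi psi)).
move=> x n /=.
by rewrite tens_mapE gE; apply: E; rewrite ?sK ?rK.
Qed.

End TensorKernel.

Section Image.
Variables (U V : zmodType) (f : {additive U -> V}).
Fact img_mem0 : exists u, f u = 0.
Proof. by exists 0; rewrite raddf0. Qed.
Fact img_memB v w : (exists u, f u = v) -> (exists u, f u = w) ->
  exists u, f u = v - w.
Proof. by move=> [x <-] [y <-]; exists (x - y); rewrite raddfB. Qed.
(** The image of a morphism, as a subgroup. *)
Definition img : subgroup V :=
  @Subgroup V (fun v => exists u, f u = v) img_mem0 img_memB.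
End Image.

Section RightExact.
Variables (B : pzRingType).

Lemma tens_map_surj (X X' : lmodType B^c) (N N' : lmodType B)
    (phi : {linear X -> X'}) (psi : {linear N -> N'}) :
  surjective phi -> surjective psi -> surjective (tens_map phi psi).
Proof.
move=> pS qS; apply: (@tens_ind _ _ _ (img _)) => x' n'.
have [x <-] := pS x'; have [n <-] := qS n'.
by exists (tmul x n); rewrite tens_mapE.
Qed.

Lemma tens_exactr (X : lmodType B^c) (N N' N'' : lmodType B)
    (f : {linear N' -> N}) (g : {linear N -> N''}) :
    surjective g -> exact_at f g ->
  exact_at (tens_map (idfun : {linear X -> X}) f)
           (tens_map (idfun : {linear X -> X}) g).
Proof.
move=> gS fg t; split=> [|[u <-]].
  apply: (@tens_map_ker _ _ _ _ _ _ _ _ _ (img (tens_map idfun f))) =>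
    [y|//|x n|x n].
  - by exists y.
  - by move=> /= ->; exists 0; rewrite tmul0l raddf0.
  - by move=> /fg[n' <-]; exists (tmul x n'); rewrite tens_mapE.
apply: (@tens_ext _ _ _ _ (tens_map _ g \o tens_map _ f) \0) => x n /=.
by rewrite !tens_mapE /= (proj2 (fg _)) ?tmul0r //; exists n.
Qed.

Lemma tens_exactl (X X' X'' : lmodType B^c) (N : lmodType B)
    (f : {linear X' -> X}) (g : {linear X -> X''}) :
    surjective g -> exact_at f g ->
  exact_at (tens_map f (idfun : {linear N -> N}))
           (tens_map g (idfun : {linear N -> N})).
Proof.
move=> gS fg t; split=> [|[u <-]].
  apply: (@tens_map_ker _ _ _ _ _ _ _ _ _ (img (tens_map f idfun))) =>
    [//|y|x n|x n].
  - by exists y.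
  - by move=> /fg[x' <-]; exists (tmul x' n); rewrite tens_mapE.
  - by move=> /= ->; exists 0; rewrite tmul0r raddf0.
apply: (@tens_ext _ _ _ _ (tens_map g _ \o tens_map f _) \0) => x n /=.
by rewrite !tens_mapE /= (proj2 (fg _)) ?tmul0l //; exists x.
Qed.

Lemma tens_map_comp (X X' X'' : lmodType B^c) (N N' N'' : lmodType B)
    (f : {linear X -> X'}) (f' : {linear X' -> X''})
    (g : {linear N -> N'}) (g' : {linear N' -> N''})
    (h : {linear X -> X''}) (k : {linear N -> N''}) t :
    (forall x, f' (f x) = h x) -> (forall n, g' (g n) = k n) ->
  tens_map f' g' (tens_map f g t) = tens_map h k t.
Proof.
move=> fh gk.
apply: (@tens_ext _ _ _ _ (tens_map f' g' \o tens_map f g) (tens_map h k)).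
by move=> x n /=; rewrite !tens_mapE fh gk.
Qed.

End RightExact.

(** * Vanishing of Tor and dimension shifting *)

Section ShortExact.
Variables (B : pzRingType).
Implicit Types U V W N P K : lmodType B.

(** The sequence [0 -> U -> V -> W -> 0] is exact. *)
Definition ses U V W (i : {linear U -> V}) (p : {linear V -> W}) :=
  [/\ injective i, exact_at i p & surjective p].

Lemma ker_incl_inj U V (f : {linear U -> V}) : injective (ker_incl f).
Proof. exact: val_inj. Qed.

Lemma ker_exact U V (f : {linear U -> V}) : exact_at (ker_incl f) f.
Proof.
move=> y; split=> [fy|[x <-]]; last by apply/eqP; case: x.
by exists (Ker (introT eqP fy : y \in kerp f)).
Qed.

Lemma cover_surj N : surjective (cover N).
Proof. by move=> x; exists (fgen x); rewrite /cover flift_gen. Qed.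

Lemma ses_ker U V (f : {linear U -> V}) : surjective f -> ses (ker_incl f) f.
Proof. by split=> //; [exact: ker_incl_inj | exact: ker_exact]. Qed.

Lemma ses_cover N : ses (ker_incl (cover N)) (cover N).
Proof. exact/ses_ker/cover_surj. Qed.

Lemma exact_lift U V W N (i : {linear U -> V}) (p : {linear V -> W})
    (h : {linear N -> V}) : injective i -> exact_at i p ->
    (forall n, p (h n) = 0) ->
  exists h' : {linear N -> U}, forall n, i (h' n) = h n.
Proof.
move=> iI ip ph; have [g gK] := choice (fun n => proj1 (ip (h n)) (ph n)).
have gL : linear g by move=> a x y; apply: iI; rewrite !(linearP, gK).
by exists (lin gL).
Qed.

Lemma free_ext (X : choiceType) V (f g : {linear free_mod B X -> V}) :
  (forall x, f (fgen x) = g (fgen x)) -> f =1 g.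
Proof.
move=> fg u; have [s [us sP]] := finsuppP u u.
rewrite (free_sum u) /flift /= (@flift_funE _ _ _ _ _ s) //.
  by rewrite !linear_sum; apply: eq_bigr => x _; rewrite !linearZZ fg.
by move=> x /(proj1 (sP x)).
Qed.

Lemma free_projective (X : choiceType) : projective (free_mod B X).
Proof.
move=> U V p f pS; have [h hK] := choice pS.
exists (flift (fun x => h (f (fgen x)))).
apply: (@free_ext _ _ (p \o flift _)) => x /=.
by rewrite [flift_fun _ _]flift_gen hK.
Qed.

(** [N] is a retract of [N'] up to an endomorphism of [N] that factors through
  a projective module. *)
Definition stable_retract N N' :=
  exists (f : {linear N -> N'}) (g : {linear N' -> N}) (E : lmodType B)
         (a : {linear N -> E}) (b : {linear E -> N}),
    projective E /\ forall x, g (f x) = x + b (a x).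

Lemma stable_retract_refl N : stable_retract N N.
Proof.
exists idfun, idfun, (free_mod B N), \0, \0.
split; first exact: free_projective.
by move=> x /=; rewrite addr0.
Qed.

Section SchanuelComparison.
Variables (N N' K P K' P' : lmodType B) (i : {linear K -> P})
  (p : {linear P -> N}) (i' : {linear K' -> P'}) (p' : {linear P' -> N'}).
Hypotheses (NN' : stable_retract N N') (ip : ses i p) (ip' : ses i' p')
  (PP : projective P) (PP' : projective P').

(** The two maps of a stable retraction [N -> N' -> N] lift to the projective
  presentations. The composite of the lifts differs from the identity of [P] by
  a map through the auxiliary projective module and a map [c] into [K]; only the
  latter survives on [K]. *)
Lemma stable_retract_lift :
  exists (F : {linear P -> P'}) (f : {linear K -> K'}) (g : {linear K' -> K})
         (c : {linear P -> K}),
    (forall k, i' (f k) = F (i k)) /\ (forall k, g (f k) = k + c (i k)).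
Proof.
move: NN' ip ip' => [f [g [E [a [b [EP gf]]]]]] [iI ipE pS] [i'I ipE' p'S].
have [F FE] := PP (f \o p) p'S.
have [G GE] := PP' (g \o p') pS.
have [b' bE] := EP _ _ p b pS.
have [F' F'E] : exists F' : {linear K -> K'}, forall k, i' (F' k) = F (i k).
  apply: (@exact_lift _ _ _ _ i' p' (F \o i)) => // n /=.
  by rewrite FE /= (proj2 (ipE _)) ?linear0 //; exists n.
have [G' G'E] : exists G' : {linear K' -> K}, forall k, i (G' k) = G (i' k).
  apply: (@exact_lift _ _ _ _ i p (G \o i')) => // n /=.
  by rewrite GE /= (proj2 (ipE' _)) ?linear0 //; exists n.
have [c cE] : exists c : {linear P -> K}, forall x,
    i (c x) = G (F x) - x - b' (a (p x)).
  pose h : {linear P -> P} := (G \o F : {linear P -> P})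
    - (idfun : {linear P -> P}) - (b' \o a \o p : {linear P -> P}).
  apply: (@exact_lift _ _ _ _ i p h) => // n.
  rewrite /h !linear_addE !linear_oppE /= !linearB /= GE /= FE /= bE gf.
  by rewrite addrAC addrK subrr.
exists F, F', G', c; split=> // x; apply: iI.
rewrite linearD G'E F'E cE (proj2 (ipE _)) ?linear0 ?subr0; last by exists x.
by rewrite addr0 addrC subrK.
Qed.

Lemma stable_retract_syzygy : stable_retract K K'.
Proof.
have [F [f [g [c [_ gf]]]]] := stable_retract_lift.
by exists f, g, P, i, c.
Qed.

Lemma stable_retract_inj (X : lmodType B^c) :
    injective (tens_map (idfun : {linear X -> X}) i') ->
  injective (tens_map (idfun : {linear X -> X}) i).
Proof.
move=> /additive_injP i'I; apply/additive_injP => t it.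
have [F [f [g [c [fE gf]]]]] := stable_retract_lift.
have ft : tens_map (idfun : {linear X -> X}) f t = 0.
  apply: i'I; rewrite (tens_map_comp (h := idfun) (k := F \o i)) //.
  by rewrite -(tens_map_comp (f := idfun) (f' := idfun) (g := i) (g' := F)) //
    it raddf0.
have : tens_map (idfun : {linear X -> X}) g (tens_map idfun f t) =
    t + tens_map (idfun : {linear X -> X}) c (tens_map idfun i t).
  apply: (@tens_ext _ _ _ _ (tens_map _ g \o tens_map _ f)
    (idfun \+ (tens_map _ c \o tens_map _ i))) => x n /=.
  by rewrite !tens_mapE /= gf tmulDr.
by rewrite ft it !raddf0 addr0.
Qed.

End SchanuelComparison.

End ShortExact.

Section TorVanishing.
Variables (B : pzRingType).
Implicit Types (X : lmodType B^c) (N K P : lmodType B).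

(** [Tor_1(X, N) = 0], read off from the standard cover of [N]. *)
Definition tor1_zero X N :=
  injective (tens_map (idfun : {linear X -> X}) (ker_incl (cover N))).

Lemma homology_zeroP (U V W : zmodType) (f : {additive U -> V})
    (g : {additive V -> W}) :
  is_zero (homology f g) <-> forall v, g v = 0 -> exists u, f u = v.
Proof.
have zE (z : cycle g) : (\pi_(homology f g) z)%qT = 0 <-> exists u, f u = val z.
  have <- : (\pi_(homology f g) 0)%qT = 0 by exact: raddf0.
  split=> [/eqP|zu].
    by rewrite -Quotient.idealrBE subr0 => /asboolP.
  by apply/eqP; rewrite -Quotient.idealrBE subr0; apply/asboolP.
split=> [H0 v gv|H q].
  have gv' : v \in zkerp g by apply/eqP.
  by have /zE := H0 (\pi_(homology f g) (Cycle gv'))%qT.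
rewrite -[q]reprK; apply/zE/H; exact/eqP/(valP (repr q)).
Qed.

(** By right exactness, exactness of the complex defining [Tor_(j+1)] says that
  the inclusion of the [(j+1)]-st syzygy stays injective after tensoring. *)
Lemma Tor_zeroP X N j : is_zero (Tor j.+1 X N) <-> tor1_zero X (syzygy N j).
Proof.
have dE k v : tens_d X N k v = tens_map idfun (ker_incl (cover (syzygy N k)))
      (tens_map idfun (cover (syzygy N k.+1)) v).
  by rewrite (tens_map_comp (h := idfun) (k := resol_d N k)).
have cS k :
    surjective (tens_map (idfun : {linear X -> X}) (cover (syzygy N k))).
  by apply: tens_map_surj; [move=> x; exists x | exact: cover_surj].
have cE k : exact_at (tens_map (idfun : {linear X -> X})
    (ker_incl (cover (syzygy N k)))) (tens_map idfun (cover (syzygy N k))).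
  by apply: tens_exactr; [exact: cover_surj | exact: ker_exact].
rewrite homology_zeroP; split=> [H|/additive_injP T v].
  apply/additive_injP => t; have [v <-] := cS j.+1 t; rewrite -dE => /H[u <-].
  by rewrite dE; apply/(cE j.+1); eexists.
rewrite dE => /T /(cE j.+1)[w <-]; have [u <-] := cS j.+2 w.
by exists u; rewrite dE.
Qed.

(** [Tor_1] may be computed from any projective presentation. *)
Lemma tor1_zero_ses X N K P (i : {linear K -> P}) (p : {linear P -> N}) :
    ses i p -> projective P ->
  tor1_zero X N <-> injective (tens_map (idfun : {linear X -> X}) i).
Proof.
move=> ip PP; have FP := @free_projective B N.
split.
  exact: (stable_retract_inj (stable_retract_refl N) ip (ses_cover N) PP FP).
exact: (stable_retract_inj (stable_retract_refl N) (ses_cover N) ip FP PP).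
Qed.

(** Dimension shifting along a projective presentation of the left module. *)
Lemma tor1_zero_shiftr X N K P (i : {linear K -> P}) (p : {linear P -> N}) j :
    ses i p -> projective P ->
  tor1_zero X (syzygy N j.+1) <-> tor1_zero X (syzygy K j).
Proof.
move=> ip PP.
have [NK KN] : stable_retract (syzygy N j.+1) (syzygy K j) /\
               stable_retract (syzygy K j) (syzygy N j.+1).
  elim: j => [|j [IH1 IH2]] /=.
    have NN := stable_retract_refl N; have FP := @free_projective B N.
    split; first exact: (stable_retract_syzygy NN (ses_cover N) ip FP PP).
    exact: (stable_retract_syzygy NN ip (ses_cover N) PP FP).
  by split; [apply: (stable_retract_syzygy IH1 (ses_cover _) (ses_cover _)) |
    apply: (stable_retract_syzygy IH2 (ses_cover _) (ses_cover _))];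
  exact: free_projective.
by split; [apply: (stable_retract_inj KN (ses_cover _) (ses_cover _)) |
    apply: (stable_retract_inj NK (ses_cover _) (ses_cover _))];
  exact: free_projective.
Qed.

End TorVanishing.

Section FiniteDualBasis.
Variables (C : pzRingType).

(** Finitely generated projective modules, given by a finite dual basis. *)
Definition dual_basis (P : lmodType C) :=
  exists k (e : 'I_k -> P) (phi : 'I_k -> {linear P -> C^o}),
    forall x, x = \sum_(j < k) (phi j x : C) *: e j.

Lemma dual_basis_projective (P : lmodType C) : dual_basis P -> projective P.
Proof.
move=> [k [e [phi eK]]] U V p f pS; have [h hK] := choice pS.
have gL : linear (fun x => \sum_(j < k) (phi j x : C) *: h (f (e j))).
  move=> a x y; rewrite scaler_sumr -big_split; apply: eq_bigr => j _ /=.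
  by rewrite linearP scalerDl scalerA.
exists (lin gL) => x /=; rewrite [in RHS](eK x) !linear_sum.
by apply: eq_bigr => j _; rewrite !linearZZ hK.
Qed.

Lemma projective_dual_basis (P : lmodType C) :
  fingen P -> projective P -> dual_basis P.
Proof.
move=> [k [e eP]] PP.
have pL : linear (fun c : {ffun 'I_k -> C^o} => \sum_j (c j : C) *: e j).
  move=> a x y; rewrite scaler_sumr -big_split; apply: eq_bigr => j _ /=.
  by rewrite !ffunE scalerDl scalerA.
have pS : surjective (lin pL).
  move=> x; have [c ->] := eP x; exists [ffun j => c j] => /=.
  by apply: eq_bigr => j _; rewrite ffunE.
have [g gK] := PP _ _ _ (idfun : {linear P -> P}) pS.
have phiL j : linear (fun x => g x j : C^o).
  by move=> a x y; rewrite linearP !ffunE.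
by exists k, e, (fun j => lin (phiL j)) => x; rewrite -[LHS]gK.
Qed.

End FiniteDualBasis.

Section Flatness.
Variables (B : pzRingType).

(** The map [p (x) n |-> phi p n] given by a functional [phi] on [P]. *)
Definition contract (P : lmodType B^c) (N : lmodType B)
    (phi : {linear P -> (B^c)^o}) : {additive tens P N -> N}.
Proof.
refine (@tlift B P N N (fun p n => (phi p : B) *: n) _ _ _).
- by move=> x y n; rewrite linearD scalerDl.
- by move=> x m n; rewrite scalerDr.
- by move=> b x n; rewrite linearZZ scalerA.
Defined.

(** The map [x (x) u |-> x u_y], with [u_y] the coefficient of [u] at [y]. *)
Definition coordinate (X : lmodType B^c) (I : choiceType) (y : I) :
  {additive tens X (free_mod B I) -> X}.
Proof.
refine (@tlift B X (free_mod B I) X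
  (fun x u => ((coef u y : B) : B^c) *: x) _ _ _).
- by move=> x z n; rewrite scalerDr.
- by move=> x m n; rewrite -scalerDl.
- by move=> b x n; rewrite scalerA.
Defined.

Lemma dual_basis_flat (P : lmodType B^c) (N L : lmodType B)
    (i : {linear N -> L}) : dual_basis P -> injective i ->
  injective (tens_map (idfun : {linear P -> P}) i).
Proof.
move=> [k [e [phi eK]]] iI; apply/additive_injP => t it.
pose c (M : lmodType B) j := contract M (phi j).
have tE : t = \sum_j tmul (e j) (c N j t).
  have sL : zmod_morphism (fun t => \sum_j tmul (e j) (c N j t)).
    move=> u v; rewrite -sumrB; apply: eq_bigr => j _.
    by rewrite raddfB tmulDr tmulNr.
  apply: (@tens_ext _ _ _ _ idfun (addm sL)) => x n /=.
  rewrite [in LHS](eK x) tmul_suml; apply: eq_bigr => j _.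
  by rewrite tliftE tmulZ.
rewrite tE big1 // => j _.
suff -> : c N j t = 0 by rewrite tmul0r.
apply: iI; rewrite linear0 -(raddf0 (c L j)) -it.
apply: (@tens_ext _ _ _ _ (i \o c N j) (c L j \o tens_map idfun i)) => x n /=.
by rewrite tens_mapE /= !tliftE linearZZ.
Qed.

Lemma free_flat (X X' : lmodType B^c) (I : choiceType) (f : {linear X -> X'}) :
  injective f ->
  injective (tens_map f (idfun : {linear free_mod B I -> free_mod B I})).
Proof.
move=> fI; apply/additive_injP => t ft.
pose F := free_mod B I.
pose c (Y : lmodType B^c) (y : I) := coordinate Y y.
(* All but finitely many coordinates of t vanish, and t is the sum of its
   coordinates. *)
have [s sE] : exists s : seq I, forall r, uniq r -> {subset s <= r} ->
    t = \sum_(y <- r) tmul (c X y t) (fgen y).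
  pose P (t : tens X F) := exists s : seq I, forall r, uniq r ->
    {subset s <= r} -> t = \sum_(y <- r) tmul (c X y t) (fgen y).
  have P0 : P 0.
    exists [::] => r _ _; rewrite big1_seq // => y _; by rewrite raddf0 tmul0l.
  have PB u v : P u -> P v -> P (u - v).
    move=> [s sE] [s' s'E]; exists (s ++ s') => r ur sr.
    under eq_bigr do rewrite raddfB tmulDl tmulNl.
    rewrite sumrB -(sE r ur) -?(s'E r ur) // => y ys; apply: sr;
      by rewrite mem_cat ys ?orbT.
  apply: (@tens_ind _ _ _ (Subgroup P0 PB)) => x u /=.
  have [s [us sP]] := finsuppP u u; exists s => r ur sr.
  rewrite [in LHS](free_sum u) /flift /= (@flift_funE _ _ _ _ _ r) //;
    last by move=> y /(proj1 (sP y))/sr.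
  by rewrite tmul_sumr; apply: eq_bigr => y _; rewrite tliftE tmulZ.
rewrite (sE (undup s)) ?undup_uniq // => [|y]; last by rewrite mem_undup.
rewrite big1 // => y _; suff -> : c X y t = 0 by rewrite tmul0l.
apply: fI; rewrite linear0 -(raddf0 (c X' y)) -ft.
apply: (@tens_ext _ _ _ _ (f \o c X y) (c X' y \o tens_map f idfun)) => x n /=.
by rewrite tens_mapE /= !tliftE linearZZ.
Qed.

Section ShiftLeft.
Variables (X K P : lmodType B^c) (i : {linear K -> P}) (p : {linear P -> X}).
Hypotheses (ip : ses i p) (Pdb : dual_basis P).

(** Balancedness of [Tor_1]: it may be computed from a presentation of the
  right module instead of the left one. *)
Lemma tor1_zero_sesl (N : lmodType B) :
  tor1_zero X N <-> injective (tens_map i (idfun : {linear N -> N})).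
Proof.
have [iI ipE pS] := ip; have [jI jE qS] := ses_cover N.
set j := ker_incl (cover N) in jI jE; set q := cover N in jE qS.
rewrite /tor1_zero -/j.
have Pj := dual_basis_flat Pdb jI.
have iF := @free_flat _ _ N _ iI.
have sq (Y Z : lmodType B^c) (f : {linear Y -> Z}) (M L : lmodType B)
    (g : {linear M -> L}) t :
    tens_map f idfun (tens_map idfun g t) =
    tens_map idfun g (tens_map f idfun t).
  by rewrite !(tens_map_comp (h := f) (k := g)).
have pSt (M : lmodType B) : surjective (tens_map p (idfun : {linear M -> M})).
  by apply: tens_map_surj => // x; exists x.
have qSt (Y : lmodType B^c) : surjective (tens_map (idfun : {linear Y -> Y}) q).
  by apply: tens_map_surj => // x; exists x.
(* Both directions chase the diagram of the maps induced by i, p, j and q, in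
   which id_P (x) j and the map of i at the cover of N are injective. *)
split=> /additive_injP H; apply/additive_injP => t t0.
  have [u ut] := qSt _ t; rewrite -ut sq in t0.
  have [v vu] := proj1 (tens_exactr qS jE _) t0.
  have pv : tens_map p idfun v = 0.
    apply: H; rewrite -sq vu (proj2 (tens_exactl pS ipE _)) //; by exists u.
  have [w wv] := proj1 (tens_exactl pS ipE _) pv.
  have uw : tens_map (idfun : {linear K -> K}) j w = u.
    by apply: iF; rewrite sq wv.
  by rewrite -ut -uw; apply/(tens_exactr qS jE); exists w.
have [v vt] := pSt _ t; rewrite -vt -sq in t0.
have [u uv] := proj1 (tens_exactl pS ipE _) t0.
have qu : tens_map idfun q u = 0.
  apply: H; rewrite sq uv (proj2 (tens_exactr qS jE _)) //; by exists v.
have [w wu] := proj1 (tens_exactr qS jE _) qu.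
have vw : tens_map i idfun w = v by apply: Pj; rewrite -sq wu.
by rewrite -vt -vw; apply/(tens_exactl pS ipE); exists w.
Qed.

(** Dimension shifting along a projective presentation of the right module. *)
Lemma tor1_zero_shiftl (N : lmodType B) j :
  tor1_zero X (syzygy N j.+1) <-> tor1_zero K (syzygy N j).
Proof.
rewrite tor1_zero_sesl /tor1_zero.
have [iI _ _] := ip; have [jI _ _] := ses_cover (syzygy N j).
have Pj := dual_basis_flat Pdb jI.
have iF := @free_flat _ _ (syzygy N j) _ iI.
set g := ker_incl _ in jI Pj *.
have sq t : tens_map i idfun (tens_map idfun g t) =
    tens_map (idfun : {linear P -> P}) g (tens_map i idfun t).
  by rewrite !(tens_map_comp (h := i) (k := g)).
(* Both maps become the diagonal of the square of i and g after an injective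
   map: id_P (x) g by flatness of P, i (x) id by flatness of the cover. *)
split=> H x y xy.
  by apply: H; apply: Pj; rewrite -!sq xy.
by apply: H; apply: iF; rewrite !sq xy.
Qed.

End ShiftLeft.
End Flatness.

(** * Modules in [add Q] *)

(** A morphism from a right exact sequence [U' -> U -> U'' -> 0] to a left
  exact one [0 -> K -> T -> M] with bijective middle component. *)
Section Chase.
Variables (U' U U'' K T M : zmodType).
Variables (a1 : {additive U' -> U}) (a2 : {additive U -> U''}).
Variables (b1 : {additive K -> T}) (b2 : {additive T -> M}).
Variables (c' : {additive U' -> K}) (c : {additive U -> T})
  (c'' : {additive U'' -> M}).
Hypotheses (a2S : surjective a2) (aE : exact_at a1 a2) (b1I : injective b1)
  (bE : exact_at b1 b2) (cB : bijective c).
Hypotheses (cc' : forall x, b1 (c' x) = c (a1 x))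
  (cc'' : forall x, b2 (c x) = c'' (a2 x)).

Lemma chase_surj_inj : surjective c' <-> injective c''.
Proof.
have /bijectiveP[cI cS] := cB; split=> [c'S|c''I k].
  apply/additive_injP => x; have [u <-] := a2S x.
  rewrite -cc'' => /bE[k kE]; apply/aE; have [u' u'E] := c'S k.
  by exists u'; apply: cI; rewrite -cc' u'E kE.
have [u uE] := cS (b1 k).
have [u' u'E] : exists u', a1 u' = u.
  apply/aE/c''I; rewrite raddf0 -cc'' uE; apply/bE; by exists k.
by exists u'; apply: b1I; rewrite cc' u'E.
Qed.

Lemma chase_inj : injective c' <-> injective a1.
Proof.
have /bijectiveP[cI cS] := cB; split=> [c'I x y xy|a1I x y xy].
  by apply/c'I/b1I; rewrite !cc' xy.
by apply/a1I/cI; rewrite -!cc' xy.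
Qed.

Lemma chase_surj : surjective b2 -> surjective c''.
Proof.
have /bijectiveP[_ cS] := cB => b2S m; have [t <-] := b2S m.
by have [u <-] := cS t; exists (a2 u); rewrite cc''.
Qed.

End Chase.

Lemma lin_sumE (R : pzRingType) (U V : lmodType R) I (r : seq I)
    (F : I -> {linear U -> V}) x :
  (\sum_(i <- r) F i) x = \sum_(i <- r) F i x.
Proof. by elim/big_rec2: _ => // i a b _ <-. Qed.

Section AddBasis.
Variables (A : pzRingType) (Q : lmodType A).

(** The identity of [T] is a finite sum of endomorphisms factoring through
  [Q], equivalently [T] belongs to [add Q]. *)
Definition add_basis (T : lmodType A) :=
  exists k (u : 'I_k -> {linear T -> Q}) (v : 'I_k -> {linear Q -> T}),
    forall t, t = \sum_(j < k) v j (u j t).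

(** [v j] embeds [Q] as the [j]-th factor of [Q^k] and projects onto [T]. *)
Lemma in_add_basis T : in_add Q T -> add_basis T.
Proof.
move=> [k [Y [f [g fK gK]]]].
have gL : linear g.
  by move=> a x y; apply: (can_inj fK); rewrite linearP !gK.
pose E j (q : Q) : {ffun 'I_k -> Q} := [ffun l => if l == j then q else 0].
have uL j : linear (fun t : T => f (t, 0) j).
  move=> a x y; rewrite -[(a *: x + y, 0)]/((a *: x + y), 0 : Y).
  have -> : (a *: x + y, 0 : Y) = a *: (x, 0) + (y, 0).
    by congr pair; rewrite /= scaler0 addr0.
  by rewrite linearP !ffunE.
have vL j : linear (fun q => (g (E j q)).1).
  move=> a x y; rewrite (_ : E j _ = a *: E j x + E j y) ?gL //.
  by apply/ffunP => l; rewrite !ffunE; case: eqP; rewrite // scaler0 addr0.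
exists k, (fun j => lin (uL j)), (fun j => lin (vL j)) => t /=.
rewrite -(raddf_sum (fst : {additive (T * Y)%type -> T})).
rewrite -(linear_sum (lin gL)) /=.
rewrite (_ : \sum_i _ = f (t, 0)) ?fK //.
apply/ffunP => l; rewrite sum_ffunE (bigD1 l) //= big1 ?addr0 ?ffunE ?eqxx //.
by move=> j /negPf jl; rewrite ffunE eq_sym jl.
Qed.

Lemma in_add_power k : in_add Q {ffun 'I_k -> Q}.
Proof.
exists k, {ffun 'I_0 -> Q}, fst.
exists (fun f => (f, 0)) => //= -[f g] /=; congr pair.
by apply/ffunP => -[].
Qed.

End AddBasis.

(** * The counit [Q (x)_B Hom_A(Q, M) -> M] *)
Section ChiLeft.
Variables (A : pzRingType) (Q : lmodType A).
Implicit Types M N T K : lmodType A.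

Fact homl_map_linear M N (d : {linear M -> N}) :
  linear (postcomp d : homl Q M -> homl Q N).
Proof. by move=> a f g; apply: linear_eqP => x /=; rewrite linearD. Qed.
(** The functor [Hom_A(Q, -)] on morphisms. *)
Definition homl_map M N (d : {linear M -> N}) :
  {linear homl Q M -> homl Q N} := lin (homl_map_linear d).

Lemma chi_natural M N (d : {linear M -> N}) t :
  chi_fun Q N (tens_map idfun (homl_map d) t) = d (chi_fun Q M t).
Proof.
apply: (@tens_ext _ _ _ _ (chi_fun Q N \o tens_map _ (homl_map d))
  (d \o chi_fun Q M)) => x n.
by rewrite /= tens_mapE !tliftE.
Qed.

Lemma homl_dual_basis T : add_basis Q T -> dual_basis (homl Q T).
Proof.
move=> [k [u [v uvE]]].
have phiL j : linear (fun g : homl Q T => postcomp (u j) g : (endop Q)^o).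
  by move=> a f g; apply: linear_eqP => x /=; rewrite linearD.
exists k, v, (fun j => lin (phiL j)) => g; apply: linear_eqP => x.
by rewrite [LHS]uvE [RHS](@lin_sumE A Q T).
Qed.

(** The inverse of [chi] on [add Q] sends [t] to the sum of the
  [u j t (x) v j]. *)
Lemma chi_add_bij T : add_basis Q T -> bijective (chi_fun Q T).
Proof.
move=> [k [u [v uvE]]].
have gL : zmod_morphism (fun t : T =>
    \sum_j tmul (u j t : emod Q) (v j : homl Q T)).
  move=> s t; rewrite -sumrB; apply: eq_bigr => j _.
  by rewrite linearB tmulDl tmulNl.
exists (addm gL) => [t|t]; last first.
  rewrite /= raddf_sum /= [RHS]uvE; apply: eq_bigr => j _.
  by rewrite tliftE.
apply: (@tens_ext _ _ _ _ (addm gL \o chi_fun Q T) idfun) => q g /=.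
rewrite tliftE.
(* The endomorphisms u j \o g of Q are scalars that can be moved across the
   tensor sign. *)
have [b bE] : exists b : 'I_k -> endop Q, forall j, b j = postcomp (u j) g.
  by exists (fun j => postcomp (u j) g).
transitivity
  (\sum_j tmul ((b j : (endop Q)^c) *: (q : emod Q)) (v j : homl Q T)).
  by apply: eq_bigr => j _; rewrite bE.
under eq_bigr do rewrite tmulZ.
rewrite -tmul_sumr; congr tmul; apply: linear_eqP => x.
rewrite [RHS]uvE [LHS](@lin_sumE A Q T).
by apply: eq_bigr => j _; rewrite bE.
Qed.

Lemma homl_ses K T M (i : {linear K -> T}) (p : {linear T -> M}) :
    ses i p -> surjective (@postcomp A Q _ _ p) ->
  ses (homl_map i) (homl_map p).
Proof.
move=> [iI ip _] pS; split=> // [f g fg|f].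
  apply: linear_eqP => x; apply: iI.
  exact: (congr1 (fun h : homl Q T => (h : {linear Q -> T}) x) fg).
split=> [pf|[g <-]].
  have pf0 x : p ((f : {linear Q -> T}) x) = 0.
    exact: (congr1 (fun h : homl Q M => (h : {linear Q -> M}) x) pf).
  by have [g gE] := exact_lift iI ip pf0; exists g; apply: linear_eqP.
by apply: linear_eqP => x; apply/ip; eexists.
Qed.

Section Step.
Variables (K T M : lmodType A) (i : {linear K -> T}) (p : {linear T -> M}).
Hypotheses (ip : ses i p) (TQ : add_basis Q T)
  (pQ : surjective (@postcomp A Q _ _ p)).

Let hE : exact_at (tens_map (idfun : {linear emod Q -> emod Q}) (homl_map i))
  (tens_map idfun (homl_map p)).
Proof. by have [_ ? ?] := homl_ses ip pQ; apply: tens_exactr. Qed.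
Let hS : surjective
  (tens_map (idfun : {linear emod Q -> emod Q}) (homl_map p)).
Proof.
have [_ _ ?] := homl_ses ip pQ; apply: tens_map_surj => // x.
by exists x.
Qed.

(** The counit is bijective at [T], so its cokernel at [K] is its kernel at
  [M]. *)
Lemma chi_surj_inj : surjective (chi_fun Q K) <-> injective (chi_fun Q M).
Proof.
have [iI ipE _] := ip.
apply: (chase_surj_inj hS hE iI ipE (chi_add_bij TQ)) => x;
  by rewrite chi_natural.
Qed.

Lemma chi_surj : surjective (chi_fun Q M).
Proof.
have [iI ipE pS] := ip.
apply: (chase_surj (chi_add_bij TQ) _ pS) => x; exact: esym (chi_natural p x).
Qed.

(** The induction step: [Tor_1] at [M] is the kernel of the counit of [K], and
  the higher [Tor] groups shift down from [M] to [K]. *)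
Lemma chi_step n :
  (bijective (chi_fun Q M) /\ forall j, (j < n.+1)%N ->
     tor1_zero (emod Q) (syzygy (homl Q M) j)) <->
  (bijective (chi_fun Q K) /\ forall j, (j < n)%N ->
     tor1_zero (emod Q) (syzygy (homl Q K) j)).
Proof.
have [iI ipE pS] := ip.
have TP := dual_basis_projective (homl_dual_basis TQ).
have hses := homl_ses ip pQ.
have KI : injective (chi_fun Q K) <-> tor1_zero (emod Q) (homl Q M).
  rewrite (tor1_zero_ses _ hses TP).
  apply: (chase_inj iI (chi_add_bij TQ)) => x; exact: esym (chi_natural i x).
rewrite !bijectiveP chi_surj_inj; split=> [[[cI _] tor]|[[cI cS] tor]].
  split; first by split=> //; apply/KI/(tor 0%N).
  by move=> j jn; apply/(tor1_zero_shiftr _ _ hses TP)/tor.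
split; first by split=> //; exact: chi_surj.
by case=> [_|j jn]; [apply/KI | apply/(tor1_zero_shiftr _ _ hses TP)/tor].
Qed.

End Step.

End ChiLeft.

(** * Resolutions by [add T] *)
Section Resolution.
Variables (R : comPzRingType) (A : algebra R).
Implicit Types T X M N K : lmodType A.

Fact res_map_linear M N (f : {linear M -> N}) :
  linear (f : res M -> res N).
Proof. by move=> r x y; rewrite !res_scaleE linearP. Qed.
(** An [A]-linear map, as a map of the underlying [R]-modules. *)
Definition res_map M N (f : {linear M -> N}) : {linear res M -> res N} :=
  lin (res_map_linear f).

Lemma surj_rsplit M N (f : {linear M -> N}) :
  projective (res N) -> surjective f ->
  exists s : {linear res N -> res M}, forall y : N, f (s y) = y.
Proof.
by move=> NP fS; have [s sK] := NP _ _ (res_map f) idfun fS; exists s.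
Qed.

Lemma resolution1 T X : projective (res X) ->
  resolution T X 1 <-> exists N (d : {linear N -> X}),
    [/\ in_add T N, surjective d & surjective (@postcomp A T _ _ d)].
Proof.
move=> XP; split=> [[C [d [Cadd [d0S _] _ [pS _]]]]|[N [d [Nadd dS pS]]]].
  by exists (C 0%N), (d 0%N); split=> //; apply: Cadd.
exists (fun=> N), (fun i => match i return
  {linear aug X (fun=> N) i.+1 -> aug X (fun=> N) i} with
  | 0%N => d | _.+1 => \0 : {linear N -> N} end); split=> //.
case=> // _; have [s sK] := surj_rsplit XP dS; exists s => x; by rewrite sK.
Qed.

(** A resolution of [X] is an approximation [N -> X] followed by a resolution of
  its kernel. *)
Lemma resolutionS T X n : projective (res X) ->
  resolution T X n.+2 <-> exists N (d : {linear N -> X}),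
    [/\ in_add T N, surjective d, surjective (@postcomp A T _ _ d) &
        resolution T (ker d) n.+1].
Proof.
move=> XP; split.
  move=> [C [d [Cadd [d0S dE] dR [pS pE]]]].
  exists (C 0%N), (d 0%N); split=> //; first exact: Cadd.
  have iI := @ker_incl_inj _ _ _ (d 0%N); have iE := @ker_exact _ _ _ (d 0%N).
  have [h hK] : exists h : {linear C 1%N -> ker (d 0%N)},
      forall x, ker_incl (d 0%N) (h x) = d 1%N x.
    by apply: (exact_lift iI iE) => x; apply/(dE 0%N) => //; exists x.
  have h0 x : h x = 0 <-> d 1%N x = 0.
    rewrite -hK; split=> [->|hx]; first exact: linear0.
    by apply: iI; rewrite hx linear0.
  exists (fun i => C i.+1), (fun i => match i return
    {linear aug (ker (d 0%N)) (fun i => C i.+1) i.+1 ->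
            aug (ker (d 0%N)) (fun i => C i.+1) i} with
    0%N => h | j.+1 => d j.+2 end); split.
  - by move=> i ilt; apply: Cadd.
  - split=> [k|[|i] ilt].
    + have /(dE 0%N isT)[x xk] : d 0%N (ker_incl (d 0%N) k) = 0.
        by apply/iE; exists k.
      by exists x; apply: iI; rewrite hK.
    + by move=> y; rewrite h0; apply: dE.
    + exact: dE.
  - case=> [_|i ilt]; last exact: dR.
    have [s sK] := dR 1%N isT; exists (s \o res_map (ker_incl (d 0%N))) => x.
    apply: iI; change (ker_incl (d 0%N) (h (s (ker_incl (d 0%N) (h x)))) =
      ker_incl (d 0%N) (h x)).
    by rewrite !hK sK.
  - split=> [g|[|i] ilt].
    + have [x xg] :
          exists x, postcomp (d 1%N) x = postcomp (ker_incl (d 0%N)) g.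
        apply/(pE 0%N isT); apply: linear_eqP => x; apply/iE; by exists (g x).
      exists x; apply: linear_eqP => y; apply: iI; rewrite hK.
      exact: (congr1 (fun f : {linear T -> _} => f y) xg).
    + move=> g; rewrite -(pE 1%N ilt); split=> g0; apply: linear_eqP => y;
        apply/h0; exact: (congr1 (fun f : {linear T -> _} => f y) g0).
    + exact: pE.
move=> [N [d [Nadd dS dQ [C [e [Cadd [e0S eE] eR [qS qE]]]]]]].
have iI := @ker_incl_inj _ _ _ d; have iE := @ker_exact _ _ _ d.
pose C' i := if i is j.+1 then C j else N.
exists C', (fun i => match i return {linear aug X C' i.+1 -> aug X C' i} with
  | 0%N => d
  | 1%N => ker_incl d \o e 0%N
  | j.+2 => e j.+1 end).
have i0 y : ker_incl d y = 0 <-> y = 0.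
  by split=> [hy|->]; [apply: iI; rewrite hy linear0 | exact: linear0].
split.
- by case=> [_|i ilt]; [exact: Nadd | exact: Cadd].
- split=> // -[|[|i]] ilt; last exact: eE.
  + move=> y; split=> [/iE[k <-]|[x <-]]; last by apply/iE; eexists.
    by have [x <-] := e0S k; exists x.
  + by move=> y; rewrite /= i0; apply: (eE 0%N).
- have [s sK] := surj_rsplit XP dS; case=> [_|[|i] ilt]; last exact: eR.
  + by exists s => x; rewrite sK.
  + have [r rK] : exists r : {linear res N -> res (ker d)},
        forall x, ker_incl d (r x) = x - s (d x).
      have rL : linear (fun x : res N => x - s (d x) : res N).
        move=> a x y; rewrite [d _](res_map_linear d) linearP scalerBr opprD.
        by rewrite addrACA.
      apply: (@exact_lift R _ _ _ _ (res_map (ker_incl d)) (res_map d)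
        (lin rL) iI iE).
      by move=> x; rewrite /= [d _](linearB d) sK subrr.
    have rK' k : r (ker_incl d k) = k.
      apply: iI; rewrite rK (proj2 (iE _)); last by exists k.
      by rewrite linear0 subr0.
    have [t tK] := eR 0%N isT; exists (t \o r) => x.
    change (ker_incl d (e 0%N (t (r (ker_incl d (e 0%N x))))) =
      ker_incl d (e 0%N x)).
    by rewrite rK' tK.
- split=> // -[|[|i]] ilt; last exact: qE.
  + move=> f; split=> [df|[g <-]].
      have df0 x : d (f x) = 0.
        exact: (congr1 (fun h : {linear T -> X} => h x) df).
      have [g gE] := exact_lift iI iE df0; have [h hE] := qS g.
      by exists h; apply: linear_eqP => x; rewrite -gE -hE.
    by apply: linear_eqP => x; apply/iE; eexists.
  + move=> g; rewrite -(qE 0%N ilt); split=> e0;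
      apply: linear_eqP => y; apply/i0.
      exact: (congr1 (fun f : {linear T -> _} => f y) e0).
    by move: (congr1 (fun f : {linear T -> _} => f y) e0) => /= ->.
Qed.

End Resolution.

(** * Finite generation of [Hom_A(M, N)] *)
Section Noetherian.
Variables (R : comPzRingType).
Hypothesis (hR : noetherian R).

(** Every submodule of the span of [g 0, ..., g (n - 1)] is finitely
  generated. *)
Lemma noetherian_span (M : lmodType R) (g : nat -> M) n (S : M -> Prop) :
    S 0 -> (forall x y, S x -> S y -> S (x + y)) ->
    (forall a x, S x -> S (a *: x)) ->
    (forall x, S x -> exists c : nat -> R, x = \sum_(i < n) c i *: g i) ->
  exists k (h : 'I_k -> M), (forall i, S (h i)) /\
    forall x, S x -> exists c : 'I_k -> R, x = \sum_(i < k) c i *: h i.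
Proof.
elim: n S => [|n IHn] S S0 SD SZ Sg.
  exists 0%N, (fun=> 0); split=> // x /Sg[c ->]; exists (fun=> 0).
  by rewrite !big_ord0.
have Ssum k (c : 'I_k -> R) h : (forall i, S (h i)) -> S (\sum_i c i *: h i).
  by move=> Sh; elim/big_ind: _ => // i _; apply: SZ.
pose span x := exists c : nat -> R, x = \sum_(i < n) c i *: g i.
have span0 : span 0.
  by exists (fun=> 0); rewrite big1 // => i _; rewrite scale0r.
have spanD x y : span x -> span y -> span (x + y).
  move=> [c ->] [d ->]; exists (fun i => c i + d i); rewrite -big_split.
  by apply: eq_bigr => i _; rewrite /= scalerDl.
have spanZ a x : span x -> span (a *: x).
  move=> [c ->]; exists (fun i => a * c i); rewrite scaler_sumr.
  by apply: eq_bigr => i _; rewrite scalerA.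
(* The ideal of the possible coefficients of g n in the elements of S. The
   elements h of S realise its generators; together with generators of the
   part of S in the span of g 0, ..., g (n - 1) they generate S. *)
pose I r := exists y, span y /\ S (y + r *: g n).
have [||| k [r [Ir rE]]] := hR (I := I).
- by exists 0; rewrite scale0r addr0.
- move=> a b [x [sx Sx]] [y [sy Sy]]; exists (x + y); split; first exact: spanD.
  by rewrite scalerDl addrACA; apply: SD.
- move=> a b [x [sx Sx]]; exists (a *: x); split; first exact: spanZ.
  by rewrite -scalerA -scalerDr; apply: SZ.
have [y yE] := choice Ir; pose h i := y i + r i *: g n.
have [|||| l [h' [Sh' h'E]]] := IHn (fun x => S x /\ span x).
- by [].
- by move=> x z [? ?] [? ?]; split; [apply: SD | apply: spanD].
- by move=> a x [? ?]; split; [apply: SZ | apply: spanZ].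
- by move=> x [].
have Sh i : S (h i) by have [] := yE i.
exists (k + l)%N,
  (fun j => match split j with inl a => h a | inr b => h' b end).
split=> [i|x Sx]; first by case: split => // b; have [] := Sh' b.
have [c cE] := Sg x Sx; rewrite big_ord_recr /= in cE.
have [|a aE] := rE (c n).
  by exists (\sum_(i < n) c i *: g i); split; [exists c | rewrite -cE].
have xE : x - \sum_i a i *: h i = \sum_(i < n) c i *: g i - \sum_i a i *: y i.
  have -> : \sum_i a i *: h i = \sum_i a i *: y i + c n *: g n.
    rewrite aE scaler_suml -big_split; apply: eq_bigr => i _.
    by rewrite scalerDr scalerA.
  by rewrite cE opprD addrACA subrr addr0.
have [|b bE] := h'E (x - \sum_i a i *: h i).
  split; first by rewrite -scaleN1r; apply: SD => //; apply/SZ/Ssum.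
  rewrite xE -scaleN1r; apply: (spanD); first by exists c.
  apply/spanZ/(big_ind span span0 spanD) => i _.
  by apply/(spanZ)/(proj1 (yE i)).
exists (fun j => match split j with inl i => a i | inr i => b i end).
rewrite big_split_ord /=.
have -> : x = \sum_i a i *: h i + \sum_i b i *: h' i by rewrite -bE addrC subrK.
congr (_ + _); apply: eq_bigr => i _.
  by rewrite (unsplitK (inl i)).
by rewrite (unsplitK (inr i)).
Qed.

Lemma fingen_fin (C : pzRingType) (M : lmodType C) (I : finType) (g : I -> M) :
  (forall m, exists c : I -> C, m = \sum_i c i *: g i) -> fingen M.
Proof.
move=> gE; exists #|I|, (fun j => g (enum_val j)) => m; have [c ->] := gE m.
exists (fun j => c (enum_val j)); rewrite (reindex (@enum_val I xpredT)) //=.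
by apply: onW_bij; apply: enum_val_bij.
Qed.

(** Evaluation at generators of [M] embeds [Hom_A(M, N)] into a power of [N]. *)
Lemma fingen_homR (A : algebra R) (M N : lmodType A) :
  fingen (res M) -> fingen (res N) -> fingen (homR M N).
Proof.
move=> [a [m mE]] [b [n nE]].
pose V := {ffun 'I_a -> res N}.
pose ev (f : homR M N) : V := [ffun i => (f : {linear M -> N}) (m i)].
have evD f g : ev (f + g) = ev f + ev g by apply/ffunP => i; rewrite !ffunE.
have evZ r f : ev (r *: f) = r *: ev f by apply/ffunP => i; rewrite !ffunE.
have evI : injective ev.
  move=> f g fg; apply: linear_eqP => x; have [c ->] := mE x.
  rewrite (linear_sum (res_map f)) (linear_sum (res_map g)).
  apply: eq_bigr => i _; rewrite !linearZZ; congr (_ *: _).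
  by move/ffunP/(_ i): fg; rewrite !ffunE.
have [k [g gE]] : fingen V.
  apply: (@fingen_fin _ V ('I_a * 'I_b)%type
    (fun ij => [ffun i => if i == ij.1 then n ij.2 else 0])) => v.
  have [c cE] := choice (fun i => nE (v i)); exists (fun ij => c ij.1 ij.2).
  rewrite -(pair_bigA _ (fun i j =>
    c i j *: [ffun l => if l == i then n j else 0] : V)) /=.
  apply/ffunP => l; rewrite sum_ffunE (bigD1 l) //= [X in _ + X]big1 => [|i il].
    rewrite addr0 sum_ffunE [LHS]cE; apply: eq_bigr => j _.
    by rewrite !ffunE eqxx.
  rewrite sum_ffunE big1 // => j _; rewrite !ffunE eq_sym (negPf il).
  by rewrite scaler0.
have [|||| l [h [hS hE]]] := @noetherian_span V
   (fun j => if insub j is Some i then g i else 0) k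
   (fun v => exists f, ev f = v).
- by exists 0; apply/ffunP => i; rewrite !ffunE.
- by move=> _ _ [f <-] [f' <-]; exists (f + f').
- by move=> r _ [f <-]; exists (r *: f).
- move=> v _; have [c cE] := gE v.
  exists (fun j => if insub j is Some i then c i else 0); rewrite cE.
  by apply: eq_bigr => i _; rewrite valK.
have [f fE] := choice hS; exists l, f => p.
have [|c cE] := hE (ev p); first by exists p.
exists c; apply: evI; rewrite cE.
elim/big_rec2: _ => [|i x y _ ->]; first by apply/ffunP => i; rewrite !ffunE.
by rewrite evD evZ fE.
Qed.

Variables (A : algebra R).
Implicit Types Q M : lmodType A.

Fact alg_act_linear Q (r : R) : linear (fun q : Q => alg_str A r *: q).
Proof. by move=> a x y; rewrite scalerDr !scalerA alg_strC. Qed.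
(** Multiplication by [r], an endomorphism of [Q]: generators over [R] thus
  generate over the endomorphism ring. *)
Definition alg_act Q (r : R) : {linear Q -> Q} := lin (alg_act_linear r).

Lemma fingen_homl Q M : fingen (homR Q M) -> fingen (homl Q M).
Proof.
move=> [k [f fE]]; exists k, f => g; have [c ->] := fE g.
exists (fun i => alg_act Q (c i)); apply: eq_bigr => i _.
by apply: linear_eqP => x /=; rewrite linearZZ.
Qed.

Lemma fingen_homr Q M : fingen (homR M Q) -> fingen (homr M Q).
Proof.
move=> [k [f fE]]; exists k, f => g; have [c ->] := fE g.
by exists (fun i => alg_act Q (c i)); apply: eq_bigr => i _; apply: linear_eqP.
Qed.

End Noetherian.

(** * Codominant dimension *)

Lemma dual_basis_fingen (C : pzRingType) (P : lmodType C) :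
  dual_basis P -> fingen P.
Proof.
move=> [k [e [phi eK]]]; exists k, e => m.
by exists (fun j => phi j m : C); apply: eK.
Qed.

Lemma dual_basis_retract (C : pzRingType) (P V : lmodType C)
    (i : {linear V -> P}) (r : {linear P -> V}) :
  (forall v, r (i v) = v) -> dual_basis P -> dual_basis V.
Proof.
move=> riK [k [e [phi eK]]].
exists k, (fun j => r (e j)), (fun j => phi j \o i) => v.
rewrite -[LHS]riK [i v]eK linear_sum; apply: eq_bigr => j _.
by rewrite linearZZ.
Qed.

Section AddDualBasis.
Variables (R : comPzRingType) (A : algebra R).
Implicit Types Q T M N K : lmodType A.

Lemma add_dual_basis Q T :
  dual_basis (res Q) -> add_basis Q T -> dual_basis (res T).
Proof.
move=> [k [e [phi eK]]] [l [u [v uvK]]].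
pose ij (s : 'I_#|{: 'I_k * 'I_l}|) := enum_val s.
exists #|{: 'I_k * 'I_l}|, (fun s => res_map (v (ij s).2) (e (ij s).1)).
exists (fun s => phi (ij s).1 \o res_map (u (ij s).2)) => t.
rewrite [LHS]uvK -(reindex (@enum_val _ {: 'I_k * 'I_l}) (P := xpredT)
  (F := fun p => (phi p.1 (u p.2 t) : R) *: res_map (v p.2) (e p.1))) /=;
  last by apply: onW_bij; apply: enum_val_bij.
rewrite -(pair_bigA _ (fun i j =>
  (phi i (u j t) : R) *: res_map (v j) (e i))) /=.
rewrite exchange_big /=; apply: eq_bigr => j _.
rewrite [X in v j X](eK (u j t)) (linear_sum (res_map (v j))).
by apply: eq_bigr => i _; rewrite linearZZ.
Qed.

Lemma ker_dual_basis N M (d : {linear N -> M}) : surjective d ->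
  projective (res M) -> dual_basis (res N) -> dual_basis (res (ker d)).
Proof.
move=> dS MP; have [s sK] := surj_rsplit MP dS.
have iI := @ker_incl_inj _ _ _ d; have iE := @ker_exact _ _ _ d.
pose h : {linear res N -> res N} :=
  (idfun : {linear res N -> res N})
  - (s \o res_map d : {linear res N -> res N}).
have [|r rE] :=
    @exact_lift R _ _ _ _ (res_map (ker_incl d)) (res_map d) h iI iE.
  move=> x; rewrite /h !linear_addE !linear_oppE /=.
  by rewrite [d _](linearB d) sK subrr.
apply: (@dual_basis_retract _ _ _ (res_map (ker_incl d)) r) => k.
apply: iI; rewrite [LHS]rE /h !linear_addE !linear_oppE /=.
have -> : d (ker_incl d k) = 0 by apply/iE; exists k.
by rewrite linear0 subr0.
Qed.

End AddDualBasis.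

Section CodominantDimension.
Variables (R : comPzRingType) (A : algebra R) (Q : lmodType A).
Hypotheses (hR : noetherian R) (QP : dual_basis (res Q)).
Implicit Types M N : lmodType A.

(** Generators [g j] of [Hom_A(Q, M)] over [B] define a map from a power of [Q]
  to [M] through which every map from [Q] factors; its image contains that of
  the counit. *)
Lemma chi_surj_approx M : fingen (res M) -> surjective (chi_fun Q M) ->
  exists N (d : {linear N -> M}),
    [/\ in_add Q N, surjective d & surjective (@postcomp A Q _ _ d)].
Proof.
move=> Mfg chiS.
have [k [g gE]] : fingen (homl Q M).
  apply: fingen_homl; apply: fingen_homR => //; exact: dual_basis_fingen.
have dL : linear (fun f : {ffun 'I_k -> Q} =>
    \sum_j (g j : {linear Q -> M}) (f j)).
  move=> a x y; rewrite scaler_sumr -big_split; apply: eq_bigr => j _ /=.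
  by rewrite !ffunE linearP.
have pS : surjective (@postcomp A Q _ _ (lin dL)).
  move=> f; have [c cE] := gE f.
  have hL : linear (fun q : Q => [ffun j => (c j : endo Q) q]).
    by move=> a x y; apply/ffunP => j; rewrite !ffunE linearP.
  exists (lin hL); apply: linear_eqP => q; rewrite cE [RHS](@lin_sumE A Q M) /=.
  by apply: eq_bigr => j _; rewrite ffunE.
exists {ffun 'I_k -> Q}, (lin dL); split=> //; first exact: in_add_power.
move=> m; have [t <-] := chiS m.
pose S := img (lin dL); pose S' := @Subgroup (tens (emod Q) (homl Q M))
  (fun t => S (chi_fun Q M t)).
have S0 : S (chi_fun Q M 0) by rewrite raddf0; apply: sg_mem0.
have SB u v : S (chi_fun Q M u) -> S (chi_fun Q M v) -> S (chi_fun Q M (u - v)).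
  by rewrite raddfB; apply: sg_memB.
apply: (@tens_ind _ _ _ (S' S0 SB)) => q f /=; rewrite tliftE.
by have [h <-] := pS f; exists (h q).
Qed.

Lemma resolution1_chi M : dual_basis (res M) ->
  resolution Q M 1 <-> surjective (chi_fun Q M).
Proof.
move=> MP; rewrite (resolution1 _ (dual_basis_projective MP)).
split=> [[N [d [/in_add_basis NQ dS dQ]]]|]; last first.
  by apply: chi_surj_approx; apply: dual_basis_fingen.
exact: (chi_surj (ses_ker dS) NQ).
Qed.

(** A resolution of length [n + 2] of [M] is one of length [n + 1] of the kernel
  of an approximation; length [1] means that the counit is surjective. *)
Lemma resolution_chi n M : dual_basis (res M) ->
  resolution Q M n.+2 <-> bijective (chi_fun Q M) /\
    forall j, (j < n)%N -> tor1_zero (emod Q) (syzygy (homl Q M) j).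
Proof.
elim: n M => [|n IHn] M MP; have Mp := dual_basis_projective MP;
  rewrite (resolutionS _ _ Mp).
  split=> [[N [d [/in_add_basis NQ dS dQ]]]|[/bijectiveP[cI cS] _]].
    have kd := ses_ker dS.
    have KP := ker_dual_basis dS Mp (add_dual_basis QP NQ).
    rewrite (resolution1_chi KP) => /(chi_surj_inj kd NQ dQ) cI.
    by split=> //; apply/bijectiveP; split=> //; apply: (chi_surj kd NQ).
  have [N [d [NQ dS dQ]]] := chi_surj_approx (dual_basis_fingen MP) cS.
  exists N, d; split=> //; have {}NQ := in_add_basis NQ.
  have KP := ker_dual_basis dS Mp (add_dual_basis QP NQ).
  exact/(resolution1_chi KP)/(chi_surj_inj (ses_ker dS) NQ dQ).
have step N (d : {linear N -> M}) : in_add Q N -> surjective d ->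
    surjective (@postcomp A Q _ _ d) -> resolution Q (ker d) n.+2 <->
    (bijective (chi_fun Q M) /\ forall j, (j < n.+1)%N ->
      tor1_zero (emod Q) (syzygy (homl Q M) j)).
  move=> /in_add_basis NQ dS dQ.
  have KP := ker_dual_basis dS Mp (add_dual_basis QP NQ).
  by rewrite (IHn _ KP) -(chi_step (ses_ker dS) NQ dQ).
split=> [[N [d [NQ dS dQ]]]|ctor]; first by move/(step _ _ NQ dS dQ).
have [|N [d [NQ dS dQ]]] := chi_surj_approx (dual_basis_fingen MP).
  by have [/bijectiveP[]] := ctor.
by exists N, d; split=> //; apply/step.
Qed.

End CodominantDimension.

(** The supremum of a downward closed set of positive integers is at least [n]
  exactly when the set contains [n]. *)
Lemma natbar_sup_ge (S : nat -> Prop) n : (0 < n)%N ->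
    (forall m k, (0 < m)%N -> (m <= k)%N -> S k -> S m) ->
  natbar_ge (natbar_sup (fun m => (0 < m)%N /\ S m)) n <-> S n.
Proof.
move=> n0 Sdown; rewrite /natbar_sup; case: pselect => [Sb|nSb] /=.
  case: ex_minnP => b /asboolP bS bmin; split=> [nb|Sn]; last exact: bS.
  apply: contrapT => nSn.
  have /bmin : upper_bound (fun m => (0 < m)%N /\ S m) n.-1.
    apply/asboolP => m [m0 Sm]; rewrite -ltnS prednK // ltnNge.
    by apply/negP => nm; apply/nSn/(Sdown _ m).
  by rewrite leqNgt (leq_trans _ nb) // ltn_predL.
split=> // _; apply: contrapT => nSn; apply: nSb; exists n.
apply/asboolP => m [m0 Sm].
by case: (leqP m n) => // /ltnW nm; case: nSn; apply: (Sdown _ m).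
Qed.

Section CodomdimResolution.
Variables (R : comPzRingType) (A : algebra R) (T X : lmodType A).

Lemma codomdim_ge n : (0 < n)%N -> projective (res X) ->
  natbar_ge (codomdim T X) n <-> resolution T X n.
Proof.
move=> n0 XP; rewrite /codomdim.
have down m k : (0 < m)%N -> (m <= k)%N -> resolution T X k -> resolution T X m.
  move=> _ mk [C [d [Cadd [dS dE] dR [pS pE]]]]; exists C, d.
  by split; [| split=> // |  | split=> //] => i im;
    [apply: Cadd | apply: dE | apply: dR | apply: pE]; apply: leq_trans im mk.
case: asboolP => [_|nap]; first exact: natbar_sup_ge.
split=> [/=|Xn]; first by rewrite leqNgt n0.
case: nap; have /(resolution1 _ XP)[N [d [NT dS dT]]] := down 1%N n isT n0 Xn.
exists N, d; split=> //; split=> // Y YT g.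
have [k [u [v uvK]]] := in_add_basis YT.
have [w wE] := choice (fun j => dT (g \o v j)).
exists (\sum_j (w j \o u j : {linear Y -> N})); apply: linear_eqP => y /=.
rewrite lin_sumE [in RHS](uvK y) !linear_sum; apply: eq_bigr => j _ /=.
exact: (congr1 (fun h : {linear T -> X} => h (u j y)) (wE j)).
Qed.

End CodomdimResolution.

(** * Coresolutions by [add T] *)

Section Cokernel.
Variables (A : pzRingType) (U V : lmodType A) (f : {linear U -> V}).

(** The cokernel of [f], an [A]-module. *)
Definition coker : Type := quot (img f).
HB.instance Definition _ := GRing.Zmodule.on coker.

Definition coker_scale (a : A) (q : coker) : coker :=
  qpi (img f) (a *: qrepr q).

Fact coker_scale_pi a v : coker_scale a (qpi (img f) v) = qpi (img f) (a *: v).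
Proof.
have /qpi_eq[u uE] := qreprK (qpi (img f) v).
by apply/qpi_eq; exists (a *: u); rewrite -scalerBr -uE; apply: (linearZZ f).
Qed.
Fact coker_scaleA a b v :
  coker_scale a (coker_scale b v) = coker_scale (a * b) v.
Proof. by rewrite -[v]qreprK !coker_scale_pi scalerA. Qed.
Fact coker_scale1 : left_id 1 coker_scale.
Proof. by move=> v; rewrite -[v]qreprK coker_scale_pi scale1r. Qed.
Fact coker_scaleDr : right_distributive coker_scale +%R.
Proof.
move=> a u v; rewrite -[u]qreprK -[v]qreprK.
by rewrite -[X in coker_scale a X]qpiD !coker_scale_pi scalerDr -qpiD.
Qed.
Fact coker_scaleDl v : {morph coker_scale^~ v : a b / a + b}.
Proof.
by move=> a b; rewrite -[v]qreprK !coker_scale_pi scalerDl -qpiD.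
Qed.
HB.instance Definition _ := GRing.Zmodule_isLmodule.Build A coker
  coker_scaleA coker_scale1 coker_scaleDr coker_scaleDl.

Fact coker_pi_linear : linear (qpi (img f) : V -> coker).
Proof. by move=> a x y; rewrite [LHS]qpiD -coker_scale_pi. Qed.
Definition coker_pi : {linear V -> coker} := lin coker_pi_linear.

Lemma coker_exact : exact_at f coker_pi.
Proof. by move=> y; apply: qpi_eq0. Qed.

Lemma coker_pi_surj : surjective coker_pi.
Proof. by move=> q; exists (qrepr q); apply: qreprK. Qed.

End Cokernel.

Lemma exact_colift (A : pzRingType) (U V W N : lmodType A)
    (i : {linear U -> V}) (p : {linear V -> W}) (h : {linear V -> N}) :
    surjective p -> exact_at i p -> (forall u, h (i u) = 0) ->
  exists h' : {linear W -> N}, forall v, h' (p v) = h v.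
Proof.
move=> pS ip hi; have [s sK] := choice pS.
have E x y : p x = p y -> h x = h y.
  move=> xy; have /ip[u uE] : p (x - y) = 0 by rewrite linearB xy subrr.
  by apply/eqP; rewrite -subr_eq0 -linearB -uE hi.
have gL : linear (fun w => h (s w)).
  by move=> a x y; rewrite -linearP; apply: E; rewrite linearP !sK.
by exists (lin gL) => v; apply: E; rewrite sK.
Qed.

Section Coresolution.
Variables (R : comPzRingType) (A : algebra R).
Implicit Types T X M N K : lmodType A.

Lemma rel_mono_inj M N (f : {linear M -> N}) : rel_mono f -> injective f.
Proof. by move=> [s sK]; apply: (can_inj sK). Qed.

Lemma rel_mono_rsplit M N (f : {linear M -> N}) :
  rel_mono f <-> injective f /\ rsplit f.
Proof.
split=> [fm|[fI [s sK]]]; last by exists s => x; apply: fI; rewrite sK.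
split; first exact: rel_mono_inj.
by have [s sK] := fm; exists s => x; rewrite sK.
Qed.

Lemma coker_rsection M N (f : {linear M -> N}) : rel_mono f ->
  exists s : {linear res (coker f) -> res N}, forall y, coker_pi f (s y) = y.
Proof.
move=> [s sK].
have pS := @coker_pi_surj _ _ _ f; have pE := @coker_exact _ _ _ f.
pose h : {linear res N -> res N} :=
  (idfun : {linear res N -> res N})
  - (res_map f \o s : {linear res N -> res N}).
have [|r rE] :=
    @exact_colift R _ _ _ _ (res_map f) (res_map (coker_pi f)) h pS pE.
  by move=> x; rewrite /h !linear_addE !linear_oppE /= sK subrr.
exists r => y; have [x <-] := pS y.
rewrite [r _]rE /h !linear_addE !linear_oppE /= [LHS](linearB (coker_pi f)).
have -> : coker_pi f (f (s x)) = 0 by apply/pE; exists (s x).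
by rewrite subr0.
Qed.

Lemma coresolution1 T X :
  coresolution T X 1 <-> exists N (f : {linear X -> N}),
    [/\ in_add T N, rel_mono f & surjective (@precomp A _ _ T f)].
Proof.
split=> [[C [d [Cadd [d0I _] dR [pS _]]]]|[N [f [Nadd fm pS]]]].
  exists (C 0%N), (d 0%N); split=> //; first exact: Cadd.
  by apply/rel_mono_rsplit; split; last exact: (dR 0%N).
have [fI fR] := proj1 (rel_mono_rsplit f) fm.
exists (fun=> N), (fun i => match i return
  {linear aug X (fun=> N) i -> aug X (fun=> N) i.+1} with
  | 0%N => f | _.+1 => \0 : {linear N -> N} end); split=> //.
by case.
Qed.

(** A coresolution of [X] is an approximation [X -> N] that splits over [R],
  followed by a coresolution of its cokernel. *)
Lemma coresolutionS T X n :
  coresolution T X n.+2 <-> exists N (f : {linear X -> N}),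
    [/\ in_add T N, rel_mono f, surjective (@precomp A _ _ T f) &
        coresolution T (coker f) n.+1].
Proof.
split.
  move=> [C [d [Cadd [d0I dE] dR [pS pE]]]].
  exists (C 0%N), (d 0%N); split=> //; first exact: Cadd.
    by apply/rel_mono_rsplit; split; last exact: (dR 0%N).
  have cS := @coker_pi_surj _ _ _ (d 0%N).
  have cE := @coker_exact _ _ _ (d 0%N).
  have [h hK] : exists h : {linear coker (d 0%N) -> C 1%N},
      forall x, h (coker_pi (d 0%N) x) = d 1%N x.
    by apply: (exact_colift cS cE) => x; apply/(dE 0%N) => //; exists x.
  have h0 (S : lmodType A) (g : {linear C 1%N -> S}) :
      precomp h g = 0 <-> precomp (d 1%N) g = 0.
    split=> g0; apply: linear_eqP => y.
      change (g (d 1%N y) = 0); rewrite -hK.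
      exact: (congr1 (fun k : {linear _ -> S} => k (coker_pi (d 0%N) y)) g0).
    have [x <-] := cS y; apply: (etrans (congr1 g (hK x))).
    exact: (congr1 (fun k : {linear _ -> S} => k x) g0).
  exists (fun i => C i.+1), (fun i => match i return
    {linear aug (coker (d 0%N)) (fun i => C i.+1) i ->
            aug (coker (d 0%N)) (fun i => C i.+1) i.+1} with
    0%N => h | j.+1 => d j.+2 end); split.
  - by move=> i ilt; apply: Cadd.
  - split=> [|[|i] ilt].
    + apply/additive_injP => q; have [x <-] := cS q => hx.
      by apply/cE/(dE 0%N isT); rewrite -hK.
    + move=> y; rewrite (dE 1%N ilt); split=> [[x <-]|[q <-]].
        by exists (coker_pi (d 0%N) x); apply: hK.
      by have [x <-] := cS q; exists x; rewrite -hK.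
    + exact: dE.
  - case=> [_|i ilt]; last exact: dR.
    have [s sK] := dR 1%N isT; exists (res_map (coker_pi (d 0%N)) \o s) => q.
    have [x <-] := cS q.
    have hs y : h (coker_pi (d 0%N) (s y)) = d 1%N (s y) by exact: hK.
    have hx : h (coker_pi (d 0%N) x) = d 1%N x by exact: hK.
    by apply: (etrans (hs _)); rewrite [in LHS]hx [in RHS]hx sK.
  - split=> [g|[|i] ilt].
    + have [x xg] : exists x, precomp (d 1%N) x = precomp (coker_pi (d 0%N)) g.
        apply/(pE 0%N isT); apply: linear_eqP => x /=.
        by rewrite [qpi _ _](proj2 (cE _)) ?linear0 //; exists x.
      exists x; apply: linear_eqP => q; have [y <-] := cS q.
      rewrite /= hK; exact: (congr1 (fun f : {linear C 0%N -> T} => f y) xg).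
    + by move=> g; rewrite h0; apply: (pE 1%N).
    + exact: pE.
move=> [N [f [Nadd fm fT [C [e [Cadd [e0I eE] eR [qS qE]]]]]]].
have cS := @coker_pi_surj _ _ _ f; have cE := @coker_exact _ _ _ f.
have [s sK] := coker_rsection fm.
have [fI fR] := proj1 (rel_mono_rsplit f) fm.
pose C' i := if i is j.+1 then C j else N.
exists C', (fun i => match i return {linear aug X C' i -> aug X C' i.+1} with
  | 0%N => f
  | 1%N => e 0%N \o coker_pi f
  | j.+2 => e j.+1 end).
have e00 y : e 0%N y = 0 <-> y = 0.
  by split=> [ey|->]; [apply: e0I; rewrite ey linear0 | exact: linear0].
split.
- by case=> [_|i ilt]; [exact: Nadd | exact: Cadd].
- split=> // -[|[|i]] ilt; last exact: eE.
  + by move=> y; rewrite /= e00; apply: cE.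
  + move=> y; rewrite (eE 0%N ilt); split=> [[q <-]|[x <-]].
      by have [x <-] := cS q; exists x.
    by exists (coker_pi f x).
- case=> [_|[|i] ilt]; [exact: fR | | exact: eR].
  have [t tK] := eR 0%N isT; exists (s \o t) => x.
  change (e 0%N (coker_pi f (s (t (e 0%N (coker_pi f x))))) =
    e 0%N (coker_pi f x)).
  by rewrite sK tK.
- split=> // -[|[|i]] ilt; last exact: qE.
  + move=> g; split=> [fg|[h <-]].
      have fg0 x : g (f x) = 0.
        exact: (congr1 (fun h : {linear X -> T} => h x) fg).
      have [g' g'E] := exact_colift cS cE fg0; have [h hE] := qS g'.
      by exists h; apply: linear_eqP => x; rewrite -g'E -hE.
    apply: linear_eqP => x /=.
    by rewrite [qpi _ _](proj2 (cE _)) ?linear0 //; exists x.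
  + move=> g; rewrite -(qE 0%N ilt); split=> e0; apply: linear_eqP => y.
      have [x <-] := cS y.
      exact: (congr1 (fun f : {linear N -> T} => f x) e0).
    exact: (congr1 (fun h : {linear coker f -> T} => h (coker_pi f y)) e0).
Qed.

Lemma coker_dual_basis M N (f : {linear M -> N}) : rel_mono f ->
  dual_basis (res N) -> dual_basis (res (coker f)).
Proof.
move=> /coker_rsection[s sK].
exact: (@dual_basis_retract _ _ _ s (res_map (coker_pi f))).
Qed.

Lemma domdim_ge T X n : (0 < n)%N ->
  natbar_ge (domdim T X) n <-> coresolution T X n.
Proof.
move=> n0; rewrite /domdim.
have down m k : (0 < m)%N -> (m <= k)%N ->
    coresolution T X k -> coresolution T X m.
  move=> _ mk [C [d [Cadd [dS dE] dR [pS pE]]]]; exists C, d.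
  by split; [| split=> // |  | split=> //] => i im;
    [apply: Cadd | apply: dE | apply: dR | apply: pE]; apply: leq_trans im mk.
case: asboolP => [_|nap]; first exact: natbar_sup_ge.
split=> [/=|Xn]; first by rewrite leqNgt n0.
case: nap; have /coresolution1[N [f [NT fm fT]]] := down 1%N n isT n0 Xn.
exists N, f; split=> //; split=> // Y YT g.
have [k [u [v uvK]]] := in_add_basis YT.
have [w wE] := choice (fun j => fT (u j \o g)).
exists (\sum_j (v j \o w j : {linear N -> Y})); apply: linear_eqP => y /=.
rewrite lin_sumE [in RHS](uvK (g y)); apply: eq_bigr => j _ /=.
by congr (v j _); exact: (congr1 (fun h : {linear X -> T} => h y) (wE j)).
Qed.

End Coresolution.

(** * The map [Hom_A(M, Q) (x)_B DQ -> DM] *)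
Section ChiDual.
Variables (R : comPzRingType) (A : algebra R) (Q : lmodType A).
Implicit Types M N T C : lmodType A.

Fact homr_map_linear M N (f : {linear M -> N}) :
  linear (precomp f : homr N Q -> homr M Q).
Proof. by move=> b g h; apply: linear_eqP. Qed.
(** The functor [Hom_A(-, Q)] on morphisms. *)
Definition homr_map M N (f : {linear M -> N}) :
  {linear homr N Q -> homr M Q} := lin (homr_map_linear f).

Fact dual_map_linear M N (f : {linear M -> N}) :
  linear (fun h : dual N => precomp (res_map f) h : dual M).
Proof. by move=> a g h; apply: linear_eqP => x /=; rewrite linearZZ. Qed.
(** The functor [D] on morphisms. *)
Definition dual_map M N (f : {linear M -> N}) : {linear dual N -> dual M} :=
  lin (dual_map_linear f).

(** The natural map [f (x) h |-> h \o f]; under the identification of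
  [Hom_A(M, Q)] with [Hom_A(DQ, DM)] it becomes [chir]. *)
Definition chi_dual M : {additive tens (homr M Q) (edual Q) -> dual M}.
Proof.
refine (@tlift _ (homr M Q) (edual Q) (dual M)
  (fun f h => dual_map (f : {linear M -> Q}) (h : dual Q)) _ _ _).
- move=> f g h; apply: linear_eqP => x.
  exact: (linearD (h : {linear res Q -> R^o})).
- by move=> f g h; apply: linearD.
- by move=> b f h; apply: linear_eqP.
Defined.

Lemma chi_dual_natural M N (f : {linear M -> N}) t :
  chi_dual M (tens_map (homr_map f) idfun t) = dual_map f (chi_dual N t).
Proof.
apply: (@tens_ext _ _ _ _ (chi_dual M \o tens_map (homr_map f) idfun)
  (dual_map f \o chi_dual N)) => g h.
by rewrite /= tens_mapE !tliftE; apply: linear_eqP.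
Qed.

Lemma homr_dual_basis T : add_basis Q T -> dual_basis (homr T Q).
Proof.
move=> [k [u [v uvE]]].
have phiL j : linear (fun f : homr T Q => precomp (v j) f : ((endop Q)^c)^o).
  by move=> b f g; apply: linear_eqP.
exists k, u, (fun j => lin (phiL j)) => f; apply: linear_eqP => x.
rewrite [X in _ X = _]uvE [RHS](@lin_sumE A T Q).
exact: (linear_sum (f : {linear T -> Q})).
Qed.

(** The inverse of [chi_dual] on [add Q] sends [h] to the sum of the
  [u j (x) (h \o v j)]. *)
Lemma chi_dual_add_bij T : add_basis Q T -> bijective (chi_dual T).
Proof.
move=> [k [u [v uvE]]].
have gL : zmod_morphism (fun h : dual T =>
    \sum_j tmul (u j : homr T Q) (dual_map (v j) h : edual Q)).
  move=> g h; rewrite -sumrB; apply: eq_bigr => j _.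
  by rewrite linearB tmulDr tmulNr.
exists (addm gL) => [t|h]; last first.
  rewrite /= raddf_sum /=; apply: linear_eqP => x.
  rewrite [LHS](@lin_sumE R (res T) R^o) [in RHS](uvE x).
  rewrite (linear_sum (h : {linear res T -> R^o})).
  by apply: eq_bigr => j _; rewrite tliftE.
apply: (@tens_ext _ _ _ _ (addm gL \o chi_dual T) idfun) => f h /=.
rewrite tliftE.
have [b bE] : exists b : 'I_k -> endop Q, forall j, b j = postcomp f (v j).
  by exists (fun j => postcomp f (v j)).
transitivity (\sum_j tmul (u j : homr T Q) (b j *: (h : edual Q))).
  by apply: eq_bigr => j _; congr tmul; apply: linear_eqP => x; rewrite bE.
under eq_bigr do rewrite -tmulZ.
rewrite -tmul_suml; congr tmul; apply: linear_eqP => x.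
rewrite [in RHS](uvE x) [LHS](@lin_sumE A T Q) linear_sum.
by apply: eq_bigr => j _; rewrite bE.
Qed.

Section Step.
Variables (M T C : lmodType A) (i : {linear M -> T}) (p : {linear T -> C}).
Hypotheses (im : rel_mono i) (ip : exact_at i p) (pS : surjective p)
  (TQ : add_basis Q T) (iQ : surjective (@precomp A _ _ Q i)).

Lemma homr_ses : ses (homr_map p) (homr_map i).
Proof.
split=> // [f g fg|f].
  apply: linear_eqP => y; have [x <-] := pS y.
  exact: (congr1 (fun h : homr T Q => (h : {linear T -> Q}) x) fg).
split=> [fi|[g <-]].
  have fi0 x : (f : {linear T -> Q}) (i x) = 0.
    exact: (congr1 (fun h : homr M Q => (h : {linear M -> Q}) x) fi).
  by have [g gE] := exact_colift pS ip fi0; exists g; apply: linear_eqP.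
apply: linear_eqP => x /=; rewrite (proj2 (ip _)) ?linear0 //; by exists x.
Qed.

Lemma dual_map_inj : injective (dual_map p).
Proof.
move=> f g fg; apply: linear_eqP => y; have [x <-] := pS y.
exact: (congr1 (fun h : dual T => (h : {linear res T -> R^o}) x) fg).
Qed.

Lemma dual_map_exact : exact_at (dual_map p) (dual_map i).
Proof.
move=> f; split=> [fi|[g <-]].
  have fi0 x : (f : {linear res T -> R^o}) (res_map i x) = 0.
    exact: (congr1 (fun h : dual M => (h : {linear res M -> R^o}) x) fi).
  have [g gE] := @exact_colift R _ _ _ _ (res_map i) (res_map p) f pS ip fi0.
  by exists g; apply: linear_eqP.
apply: linear_eqP => x /=; rewrite (proj2 (ip _)) ?linear0 //; by exists x.
Qed.

Lemma dual_map_surj : surjective (dual_map i).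
Proof.
have [s sK] := im => f; exists (precomp s (f : {linear res M -> R^o})).
by apply: linear_eqP => x /=; rewrite sK.
Qed.

Let hE (N : lmodType (endop Q)) :
  exact_at (tens_map (homr_map p) (idfun : {linear N -> N}))
    (tens_map (homr_map i) idfun).
Proof. by have [_ ? ?] := homr_ses; apply: tens_exactl. Qed.
Let hS (N : lmodType (endop Q)) :
  surjective (tens_map (homr_map i) (idfun : {linear N -> N})).
Proof.
by have [_ _ ?] := homr_ses; apply: tens_map_surj => // x; exists x.
Qed.

Lemma chi_dual_surj_inj : surjective (chi_dual C) <-> injective (chi_dual M).
Proof.
apply: (chase_surj_inj (@hS _) (@hE _) dual_map_inj dual_map_exact
  (chi_dual_add_bij TQ)) => x; by rewrite chi_dual_natural.
Qed.

Lemma chi_dual_surj : surjective (chi_dual M).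
Proof.
apply: (chase_surj (chi_dual_add_bij TQ) _ dual_map_surj) => x.
exact: esym (chi_dual_natural i x).
Qed.

(** The induction step. The exact sequence [0 -> M -> T -> C -> 0] yields a
  presentation of [Hom_A(M, Q)] with kernel [Hom_A(C, Q)], so that dimension
  shifting takes place in the first argument of [Tor]. *)
Lemma chi_dual_step n :
  (bijective (chi_dual M) /\ forall j, (j < n.+1)%N ->
     tor1_zero (homr M Q) (syzygy (edual Q) j)) <->
  (bijective (chi_dual C) /\ forall j, (j < n)%N ->
     tor1_zero (homr C Q) (syzygy (edual Q) j)).
Proof.
have TP := homr_dual_basis TQ; have hses := homr_ses.
have KI : injective (chi_dual C) <-> tor1_zero (homr M Q) (edual Q).
  rewrite (tor1_zero_sesl hses TP).
  apply: (chase_inj dual_map_inj (chi_dual_add_bij TQ)) => x.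
  exact: esym (chi_dual_natural p x).
rewrite !bijectiveP chi_dual_surj_inj; split=> [[[cI _] tor]|[[cI cS] tor]].
  split; first by split=> //; apply/KI/(tor 0%N).
  by move=> j jn; apply/(tor1_zero_shiftl hses TP)/tor.
split; first by split=> //; exact: chi_dual_surj.
by case=> [_|j jn]; [apply/KI | apply/(tor1_zero_shiftl hses TP)/tor].
Qed.

End Step.
End ChiDual.

(** * Dominant dimension *)

Section DominantDimension.
Variables (R : comPzRingType) (A : algebra R) (Q : lmodType A).
Hypotheses (hR : noetherian R) (QP : dual_basis (res Q)).
Implicit Types M N : lmodType A.

(** Generators [g j] of [Hom_A(M, Q)] define a map from [M] to a power of [Q]
  through which every map to [Q] factors. Its dual is surjective, hence a dual
  basis of [M] over [R] lifts and provides a retraction. *)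
Lemma chi_dual_surj_approx M : dual_basis (res M) ->
    surjective (chi_dual Q M) ->
  exists N (f : {linear M -> N}),
    [/\ in_add Q N, rel_mono f & surjective (@precomp A _ _ Q f)].
Proof.
move=> MP chiS.
have [k [g gE]] : fingen (homr M Q).
  by apply: fingen_homr; apply: fingen_homR => //; exact: dual_basis_fingen.
have fL : linear (fun x : M => [ffun j : 'I_k => (g j : {linear M -> Q}) x]).
  by move=> a x y; apply/ffunP => j; rewrite !ffunE linearP.
have fQ : surjective (@precomp A _ _ Q (lin fL)).
  move=> h; have [c cE] := gE h.
  have hL : linear (fun y : {ffun 'I_k -> Q} => \sum_j (c j : endo Q) (y j)).
    move=> a x y; rewrite scaler_sumr -big_split; apply: eq_bigr => j _ /=.
    by rewrite !ffunE linearP.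
  exists (lin hL); apply: linear_eqP => x; rewrite cE [RHS](@lin_sumE A M Q) /=.
  by apply: eq_bigr => j _; rewrite ffunE.
exists {ffun 'I_k -> Q}, (lin fL); split=> //; first exact: in_add_power.
have DS : surjective (dual_map (lin fL)).
  move=> h; have [t <-] := chiS h.
  pose S := img (dual_map (lin fL)).
  pose S' := @Subgroup (tens (homr M Q) (edual Q))
    (fun t => S (chi_dual Q M t)).
  have S0 : S (chi_dual Q M 0) by rewrite raddf0; apply: sg_mem0.
  have SB u v : S (chi_dual Q M u) -> S (chi_dual Q M v) ->
      S (chi_dual Q M (u - v)) by rewrite raddfB; apply: sg_memB.
  apply: (@tens_ind _ _ _ (S' S0 SB)) => q l /=; rewrite tliftE.
  by have [b <-] := fQ q; exists (dual_map b l); apply: linear_eqP.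
have [l [e [phi eK]]] := MP; have [psi psiE] := choice (fun j => DS (phi j)).
have sL : linear (fun y : res {ffun 'I_k -> Q} =>
    \sum_(j < l) ((psi j : {linear res _ -> R^o}) y : R) *: e j).
  move=> a x y; rewrite scaler_sumr -big_split; apply: eq_bigr => j _ /=.
  by rewrite linearP scalerDl scalerA.
exists (lin sL) => x; rewrite [RHS](eK x); apply: eq_bigr => j _.
by rewrite -psiE.
Qed.

Lemma coresolution1_chi_dual M : dual_basis (res M) ->
  coresolution Q M 1 <-> surjective (chi_dual Q M).
Proof.
move=> MP; rewrite coresolution1.
split=> [[N [f [/in_add_basis NQ fm fQ]]]|]; last exact: chi_dual_surj_approx.
exact: (chi_dual_surj fm NQ).
Qed.

Lemma coresolution_chi_dual n M : dual_basis (res M) ->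
  coresolution Q M n.+2 <-> bijective (chi_dual Q M) /\
    forall j, (j < n)%N -> tor1_zero (homr M Q) (syzygy (edual Q) j).
Proof.
elim: n M => [|n IHn] M MP; rewrite coresolutionS.
  split=> [[N [f [/in_add_basis NQ fm fQ]]]|[/bijectiveP[cI cS] _]].
    have CP := coker_dual_basis fm (add_dual_basis QP NQ).
    rewrite (coresolution1_chi_dual CP).
    have fE := @coker_exact _ _ _ f; have fS := @coker_pi_surj _ _ _ f.
    move=> /(chi_dual_surj_inj fE fS NQ fQ) cI.
    by split=> //; apply/bijectiveP; split=> //; apply: (chi_dual_surj fm NQ).
  have [N [f [NQ fm fQ]]] := chi_dual_surj_approx MP cS.
  exists N, f; split=> //; have {}NQ := in_add_basis NQ.
  have CP := coker_dual_basis fm (add_dual_basis QP NQ).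
  have fE := @coker_exact _ _ _ f; have fS := @coker_pi_surj _ _ _ f.
  exact/(coresolution1_chi_dual CP)/(chi_dual_surj_inj fE fS NQ fQ).
have step N (f : {linear M -> N}) : in_add Q N -> rel_mono f ->
    surjective (@precomp A _ _ Q f) -> coresolution Q (coker f) n.+2 <->
    (bijective (chi_dual Q M) /\ forall j, (j < n.+1)%N ->
      tor1_zero (homr M Q) (syzygy (edual Q) j)).
  move=> /in_add_basis NQ fm fQ.
  have CP := coker_dual_basis fm (add_dual_basis QP NQ).
  have fE := @coker_exact _ _ _ f; have fS := @coker_pi_surj _ _ _ f.
  by rewrite (IHn _ CP) -(chi_dual_step fm fE fS NQ fQ).
split=> [[N [f [NQ fm fQ]]]|ctor]; first by move/(step _ _ NQ fm fQ).
have [|N [f [NQ fm fQ]]] := chi_dual_surj_approx MP.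
  by have [/bijectiveP[]] := ctor.
by exists N, f; split=> //; apply/step.
Qed.

End DominantDimension.

(** * [Hom_A(M, Q)] and [Hom_A(DQ, DM)] *)
Section HomologyIso.
Variables (U V W U' V' W' : zmodType).
Variables (f : {additive U -> V}) (g : {additive V -> W}).
Variables (f' : {additive U' -> V'}) (g' : {additive V' -> W'}).
Variables (a : {additive U -> U'}) (b : {additive V -> V'})
  (c : {additive W -> W'}).
Hypotheses (aB : bijective a) (bB : bijective b) (cB : bijective c).
Hypotheses (fb : forall u, b (f u) = f' (a u))
  (gb : forall v, c (g v) = g' (b v)).

(** An isomorphism of complexes induces an isomorphism in homology. *)
Lemma homology_iso :
  exists h : {additive homology f g -> homology f' g'}, bijective h.
Proof.
have /bijectiveP[aI aS] := aB; have /bijectiveP[bI bS] := bB.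
have /bijectiveP[cI cS] := cB.
have bz (z : cycle g) : b (val z) \in zkerp g'.
  by apply/eqP; rewrite -gb (eqP (valP z)) raddf0.
pose B (z : cycle g) : cycle g' := Cycle (bz z).
have BB z w : B (z - w) = B z - B w by apply: val_inj; rewrite /= raddfB.
have piE (z w : cycle g) : (\pi_(homology f g) z = \pi_(homology f g) w)%qT <->
    exists u, f u = val (z - w).
  split=> [/eqP|zw]; first by rewrite -Quotient.idealrBE => /asboolP.
  by apply/eqP; rewrite -Quotient.idealrBE; apply/asboolP.
have piE' (z w : cycle g') :
    (\pi_(homology f' g') z = \pi_(homology f' g') w)%qT <->
    exists u, f' u = val (z - w).
  split=> [/eqP|zw]; first by rewrite -Quotient.idealrBE => /asboolP.
  by apply/eqP; rewrite -Quotient.idealrBE; apply/asboolP.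
have BE (z w : cycle g) : (\pi_(homology f g) z = \pi_(homology f g) w)%qT <->
    (\pi_(homology f' g') (B z) = \pi_(homology f' g') (B w))%qT.
  rewrite piE piE' -BB /=; split=> [[u uE]|[u' uE]].
    by exists (a u); rewrite -fb uE.
  by have [u au] := aS u'; exists u; apply: bI; rewrite fb au uE.
pose h (q : homology f g) : homology f' g' :=
  (\pi_(homology f' g') (B (repr q)))%qT.
have hpi z : h (\pi_(homology f g) z)%qT = (\pi_(homology f' g') (B z))%qT.
  by apply/BE; rewrite reprK.
have hL : zmod_morphism h.
  move=> p q; rewrite -[p]reprK -[q]reprK -(raddfB (\pi_(homology f g))%qT).
  by rewrite !hpi BB; apply: (raddfB (\pi_(homology f' g'))%qT).
exists (addm hL); apply/bijectiveP; split=> [p q|q].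
  by rewrite -[p]reprK -[q]reprK /= !hpi => /BE.
have [v vE] := bS (val (repr q)).
have vz : v \in zkerp g.
  apply/eqP/cI; rewrite gb vE raddf0; exact: (eqP (valP (repr q))).
exists (\pi_(homology f g) (Cycle vz))%qT; rewrite /= hpi -[RHS]reprK.
by congr (\pi_(homology f' g') _)%qT; apply: val_inj.
Qed.

End HomologyIso.

Lemma linear_inverse (C : pzRingType) (U V : lmodType C) (f : {linear U -> V}) :
  bijective f -> exists g : {linear V -> U}, cancel f g /\ cancel g f.
Proof.
move=> [g fK gK]; have gL : linear g.
  by move=> a x y; apply: (can_inj fK); rewrite linearP !gK.
by exists (lin gL).
Qed.

Lemma tens_map_bij (B : pzRingType) (X X' : lmodType B^c) (N : lmodType B)
    (phi : {linear X -> X'}) :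
  bijective phi -> bijective (tens_map phi (idfun : {linear N -> N})).
Proof.
move=> /linear_inverse[g [fK gK]]; exists (tens_map g idfun) => t.
  by apply: (@tens_ext _ _ _ _ (tens_map g idfun \o tens_map phi idfun)
    idfun) => x n; rewrite /= !tens_mapE fK.
by apply: (@tens_ext _ _ _ _ (tens_map phi idfun \o tens_map g idfun) idfun) =>
  x n; rewrite /= !tens_mapE gK.
Qed.

Lemma Tor_iso (B : pzRingType) (X X' : lmodType B^c) (N : lmodType B)
    (phi : {linear X -> X'}) i : bijective phi ->
  exists f : {additive Tor i X N -> Tor i X' N}, bijective f.
Proof.
move=> phiB; have phiT L := tens_map_bij L phiB.
have dE j t : tens_map phi idfun (tens_d X N j t) =
    tens_d X' N j (tens_map phi idfun t).
  rewrite /tens_d (tens_map_comp (h := phi) (k := resol_d N j)) //.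
  by rewrite (tens_map_comp (h := phi) (k := resol_d N j)).
case: i => [|i]; last first.
  exact: (homology_iso (phiT _) (phiT _) (phiT _) (dE _) (dE _)).
apply: (homology_iso (phiT _) (phiT _) (phiT _) (dE _)) => v /=.
exact: raddf0.
Qed.

Lemma is_zero_bij (U V : zmodType) (f : {additive U -> V}) :
  bijective f -> is_zero U <-> is_zero V.
Proof.
move=> /bijectiveP[fI fS]; split=> [U0 v|V0 u].
  by have [u <-] := fS v; rewrite (U0 u) raddf0.
by apply: fI; rewrite (V0 (f u)) raddf0.
Qed.

Section HomDuality.
Variables (R : comPzRingType) (A : algebra R) (Q M : lmodType A).
Hypothesis QP : dual_basis (res Q).

Fact homr_homD_linear :
  linear (fun f : homr M Q => dual_map (f : {linear M -> Q}) : homD Q M).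
Proof.
move=> b f g; apply: linear_eqP => h; apply: linear_eqP => x /=.
by rewrite linearD.
Qed.
(** The map [f |-> D f]; it is bijective because [Q] is reflexive over [R]. *)
Definition homr_homD : {linear homr M Q -> homD Q M} := lin homr_homD_linear.

Lemma homr_homD_bij : bijective homr_homD.
Proof.
have [k [e [phi eK]]] := QP.
have sep (x y : Q) : (forall h : {linear res Q -> R^o}, h x = h y) -> x = y.
  by move=> xy; rewrite [LHS]eK [RHS]eK; apply: eq_bigr => j _; rewrite xy.
apply/bijectiveP; split=> [f f' ff'|g].
  apply: linear_eqP => x; apply: sep => h.
  exact: (congr1 (fun F : homD Q M =>
    ((F : {linear dual Q -> dual M}) h : {linear res M -> R^o}) x) ff').
pose ev (h : dual Q) : {linear res M -> R^o} :=
  (g : {linear dual Q -> dual M}) h.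
(* F x is the element of Q on which every functional h takes the value
   g h x, written in the dual basis. *)
pose F (x : M) : Q := \sum_j alg_str A (ev (phi j) x : R) *: (e j : Q).
have FE (h : {linear res Q -> R^o}) x : h (F x) = ev h x.
  have hE : h = \sum_j (alg_str A (h (e j) : R) : op_alg A) *: (phi j : dual Q)
      :> dual Q.
    apply: linear_eqP => q; rewrite [in LHS](eK q) linear_sum.
    rewrite [RHS](@lin_sumE R (res Q) R^o); apply: eq_bigr => j _.
    rewrite linearZZ dual_scaleE -res_scaleE linearZZ; exact: mulrC.
  rewrite /F (linear_sum h) [in RHS]hE /ev linear_sum.
  rewrite [RHS](@lin_sumE R (res M) R^o); apply: eq_bigr => j _.
  rewrite -res_scaleE linearZZ linearZZ dual_scaleE -res_scaleE linearZZ.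
  exact: mulrC.
have FL : linear F.
  move=> a x y; apply: sep => h; rewrite FE !linearD /=.
  rewrite FE; congr (_ + _).
  transitivity (ev ((a : op_alg A) *: (h : dual Q)) x); last by rewrite -FE.
  by rewrite /ev linearZZ.
exists (lin FL); apply: linear_eqP => h; apply: linear_eqP => x.
exact: FE.
Qed.

Lemma chir_chi_dual t :
  chir_fun Q M (tens_map homr_homD idfun t) = chi_dual Q M t.
Proof.
apply: (@tens_ext _ _ _ _ (chir_fun Q M \o tens_map homr_homD idfun)
  (chi_dual Q M)) => f h.
by rewrite /= tens_mapE !tliftE.
Qed.

Lemma chir_bij : bijective (chir_fun Q M) <-> bijective (chi_dual Q M).
Proof.
have tB := tens_map_bij (edual Q) homr_homD_bij.
split=> cB.
  by apply: (eq_bij (bij_comp cB tB)) => t; apply: chir_chi_dual.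
have [s tK sK] := tB.
apply: (eq_bij (bij_comp cB (Bijective sK tK))) => t.
by rewrite /= -chir_chi_dual sK.
Qed.

End HomDuality.

Theorem theorem3p1p4 (R : comPzRingType) (A : algebra R) (Q : lmodType A)
    (hR : noetherian R) (hA : fg_proj_alg A) (hQ : mod_proj Q)
    (hQQ : fingen (homR Q Q) /\ projective (homR Q Q))
    (M : lmodType A) (hM : mod_proj M) (n : nat) (hn : (2 <= n)%N) :
  (natbar_ge (codomdim Q M) n <->
     bijective (chi Q M) /\
     (forall i : nat, (1 <= i <= n - 2)%N ->
        is_zero (Tor i (emod Q) (homl Q M))))
  /\
  (natbar_ge (domdim Q M) n <->
     bijective (chir Q M) /\
     (forall i : nat, (1 <= i <= n - 2)%N ->
        is_zero (Tor i (homD Q M) (edual Q)) /\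
        is_zero (Tor i (homr M Q) (edual Q))))
  /\
  (forall i : nat,
     exists f : {additive Tor i (homD Q M) (edual Q) ->
                          Tor i (homr M Q) (edual Q)}, bijective f).
Proof.
have [_ Qfg Qp] := hQ; have [_ Mfg Mp] := hM.
have QP := projective_dual_basis Qfg Qp.
have MP := projective_dual_basis Mfg Mp.
have homB := homr_homD_bij M QP.
have torI i : exists f : {additive Tor i (homD Q M) (edual Q) ->
    Tor i (homr M Q) (edual Q)}, bijective f.
  have [g [gK Kg]] := linear_inverse homB.
  by apply: (@Tor_iso _ _ _ _ g); exists (homr_homD Q M).
have shift (P : nat -> Prop) m :
    (forall i, (1 <= i <= m)%N -> P i) <-> (forall j, (j < m)%N -> P j.+1).
  by split=> H i im; [apply: H | case: i im => [|i] // im; apply: H].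
case: n hn => [|[|n]] // _; rewrite subSS subSS subn0.
split; [|split=> //].
  rewrite codomdim_ge // (resolution_chi hR QP _ MP) shift.
  by split=> -[cB tor]; split=> // j jn; apply/Tor_zeroP/tor.
rewrite domdim_ge // (coresolution_chi_dual hR QP _ MP) shift.
rewrite -(chir_bij M QP); split=> -[cB tor]; split=> // j jn.
  have z : is_zero (Tor j.+1 (homr M Q) (edual Q)) by apply/Tor_zeroP/tor.
  by split=> //; have [f /is_zero_bij fz] := torI j.+1; apply/fz.
by apply/Tor_zeroP; have [] := tor j jn.
Qed.
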